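(* Let $f:\mathbb{R}^n\to\mathbb{R}$ be a locally Lipschitz continuous definable function admitting a definable conservative field $\tilde{\mathcal{D}}_f$, and suppose $f$ is coercive: $f(y_k)\to+\infty$ for every sequence with $\|y_k\|\to+\infty$. Put $\mathcal{D}_f(x)=\mathrm{conv}(\tilde{\mathcal{D}}_f(x))$. Fix $\beta\in[0,1)$, $\varepsilon_0>0$ and $m_0\in\mathbb{R}^n$. Then for any compact subset $X_0\subset\mathbb{R}^n$ there exist constants $\alpha>0$ and $\tilde r>0$ such that the following holds. Let $\{x_k\},\{m_k\},\{g_k\}\subset\mathbb{R}^n$ and $\{\eta_k\},\{\mu_k\},\{\tau_k\}\subset\mathbb{R}$ ($k\ge0$, with the given $m_0$) satisfy, for all $k\ge 0$, $$g_k\in\mathcal{D}_f(x_k),\quad \eta_k=\frac{\mu_k}{\sqrt{\varepsilon_0+\sum_{i=1}^k\tau_i\|m_i\|^2}},\quad m_{k+1}=\beta m_k+(1-\beta)g_k,\quad x_{k+1}=x_k-\eta_km_{k+1},$$ where $\{\tau_k\}$ and $\{\mu_k\}$ are positive and non-decreasing and there is a locally bounded function $\psi:\mathbb{R}^n\to[0,\infty)$ with $\max\{\tau_k,\mu_k\}\le\sup_{0\le i\le k}\psi(x_i)$ for all $k\ge0$. If $x_0\in X_0$ and $\sup_{k\ge0}\mu_k\le\alpha$, then $f(x_k)\le\tilde r$ for all $k\ge0$, i.e. $\{x_k\}\subset\mathcal{L}_{\tilde r}:=\{x\in\mathbb{R}^n:f(x)\le\tilde r\}$.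
   Context: $\|\cdot\|$ is the Euclidean norm; $\mathrm{conv}$ the convex hull. A set-valued mapping $\mathcal{D}:\mathbb{R}^n\rightrightarrows\mathbb{R}^n$ assigns to each $x$ a subset of $\mathbb{R}^n$; it is graph-closed if its graph $\{(x,d):d\in\mathcal{D}(x)\}$ is closed and locally bounded if $\sup_{x\in K,d\in\mathcal{D}(x)}\|d\|<\infty$ for every compact $K$. A real function is locally bounded if it is bounded on compact sets. Conservative field: for $h:\mathbb{R}^n\to\mathbb{R}$ locally Lipschitz and $\mathcal{D}$ graph-closed and locally bounded, $\mathcal{D}$ is a conservative field for $h$ if for every $x$ and every absolutely continuous curve $\gamma$ with $\gamma(0)=0,\gamma(1)=x$, $h(x)=h(0)+\int_0^1\sup_{l\in\mathcal{D}(\gamma(s))}\langle l,\dot\gamma(s)\rangle ds$ (with $\sup\emptyset=-\infty$, so the values of $\mathcal{D}$ are necessarily nonempty). Definability: an o-minimal structure on $(\mathbb{R},+,\cdot)$ is a collection $\mathcal{O}=\{\mathcal{O}_p\}_{p\in\mathbb{N}}$, $\mathcal{O}_p$ a family of subsets of $\mathbb{R}^p$, such that: each $\mathcal{O}_p$ contains $\emptyset$ and is stable under finite unions, finite intersections and complements; $A\in\mathcal{O}_p$ implies $A\times\mathbb{R},\mathbb{R}\times A\in\mathcal{O}_{p+1}$; coordinate projections $\mathbb{R}^{p+1}\to\mathbb{R}^p$ map $\mathcal{O}_{p+1}$ into $\mathcal{O}_p$; $\mathcal{O}_p$ contains all zero sets of polynomials on $\mathbb{R}^p$; the elements of $\mathcal{O}_1$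 are exactly the finite unions of intervals and points. An o-minimal structure is fixed throughout; a function or set-valued mapping is definable if its graph belongs to the structure. *)

(* Defs.v *)
From HB Require Import structures.
From mathcomp Require Import all_boot all_order all_algebra.
From mathcomp Require Import all_classical all_reals all_analysis.
From mathcomp Require mpoly.

Set Implicit Arguments.
Unset Strict Implicit.
Unset Printing Implicit Defensive.

Import Order.TTheory GRing.Theory Num.Theory.
Import numFieldNormedType.Exports.

Local Open Scope classical_set_scope.
Local Open Scope ring_scope.

Definition dot (R : realType) (n : nat) (u v : 'rV[R]_n) : R :=
  \sum_(i < n) u 0 i * v 0 i.

(* The library's norm `|x| on 'rV[R]_n is the sup norm (it induces the same
   topology). *)
Definition enorm (R : realType) (n : nat) (x : 'rV[R]_n) : R :=
  Num.sqrt (dot x x).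

Definition conv_hull (R : realType) (n : nat) (A : set 'rV[R]_n) :
    set 'rV[R]_n :=
  smallest (@convex_set R 'rV[R]_n) A.

Definition locally_lipschitz (R : realType) (n : nat) (h : 'rV[R]_n -> R) :
    Prop :=
  forall x : 'rV[R]_n, exists L : R, exists2 U : set 'rV[R]_n, nbhs x U &
    forall y z, U y -> U z -> `|h y - h z| <= L * enorm (y - z).

Definition coercive (R : realType) (n : nat) (h : 'rV[R]_n -> R) : Prop :=
  forall y : nat -> 'rV[R]_n,
    enorm (y k) @[k --> \oo] --> +oo -> h (y k) @[k --> \oo] --> +oo.

Definition locally_bounded_fun (R : realType) (n : nat) (h : 'rV[R]_n -> R) :
    Prop :=
  forall K : set 'rV[R]_n, compact K ->
    exists M : R, forall x, K x -> `|h x| <= M.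

(* A set-valued mapping from R^n to R^m is a function D : 'rV_n -> set 'rV_m;
   its values may be empty. *)
Definition graph_closed (R : realType) (n m : nat)
    (D : 'rV[R]_n -> set 'rV[R]_m) : Prop :=
  closed [set z : 'rV[R]_n * 'rV[R]_m | D z.1 z.2].

Definition locally_bounded (R : realType) (n m : nat)
    (D : 'rV[R]_n -> set 'rV[R]_m) : Prop :=
  forall K : set 'rV[R]_n, compact K ->
    exists M : R, forall x d, K x -> D x d -> enorm d <= M.

(* Absolute continuity on [a, b]; the values of gam outside are irrelevant. *)
Definition absolutely_continuous_on (R : realType) (n : nat) (a b : R)
    (gam : R -> 'rV[R]_n) : Prop :=
  forall e : R, 0 < e -> exists2 d : R, 0 < d &
    forall (N : nat) (s t : 'I_N -> R),
      (forall i, a <= s i /\ s i <= t i /\ t i <= b) ->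
      trivIset [set: 'I_N] (fun i => `]s i, t i[%classic) ->
      \sum_(i < N) (t i - s i) < d ->
      \sum_(i < N) enorm (gam (t i) - gam (s i)) < e.

(* derive1 gam is a total function whose value is a default one where gam is not
   derivable, a Lebesgue-null subset of [0, 1] for absolutely continuous gam.
   The integral is extended-real valued, and ereal_sup set0 = -oo. *)
Record conservative_field (R : realType) (n : nat)
    (D : 'rV[R]_n -> set 'rV[R]_n) (h : 'rV[R]_n -> R) : Prop := {
  conservative_lipschitz : locally_lipschitz h ;
  conservative_graph_closed : graph_closed D ;
  conservative_locally_bounded : locally_bounded D ;
  conservative_integral : forall (x : 'rV[R]_n) (gam : R -> 'rV[R]_n),
    absolutely_continuous_on 0 1 gam -> gam 0 = 0 -> gam 1 = x ->
    (h x)%:E = ((h 0)%:E +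
      \int[lebesgue_measure]_(s in `[0%R, 1%R])
        ereal_sup [set (dot l (derive1 gam s))%:E | l in D (gam s)])%E }.

(* Om p is the family of definable subsets of R^p.  The cylinders A x R and
   R x A are the preimages of A under the maps forgetting the last,
   respectively the first, coordinate; col' i forgets coordinate i.  Points
   are the degenerate intervals `[a, a]. *)
Record o_minimal_structure (R : realType)
    (Om : forall p : nat, set (set 'rV[R]_p)) : Prop := {
  omin_set0 : forall p, Om p set0 ;
  omin_setU : forall p A B, Om p A -> Om p B -> Om p (A `|` B) ;
  omin_setI : forall p A B, Om p A -> Om p B -> Om p (A `&` B) ;
  omin_setC : forall p A, Om p A -> Om p (~` A) ;
  omin_prodr : forall p A, Om p A ->
    Om p.+1 [set x : 'rV[R]_p.+1 | A (col' ord_max x)] ;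
  omin_prodl : forall p A, Om p A ->
    Om p.+1 [set x : 'rV[R]_p.+1 | A (col' ord0 x)] ;
  omin_proj : forall p (i : 'I_p.+1) A, Om p.+1 A ->
    Om p [set col' i x | x in A] ;
  omin_poly : forall p (P : mpoly.mpoly p R),
    Om p [set x : 'rV[R]_p | mpoly.meval (fun i => x 0 i) P = 0] ;
  omin_dim1 : forall A : set 'rV[R]_1, Om 1 A <->
    exists s : seq (interval R),
      A = [set x : 'rV[R]_1 | exists2 I, I \in s & x 0 0 \in I] }.

Definition definable_map (R : realType)
    (Om : forall p : nat, set (set 'rV[R]_p)) (n m : nat)
    (D : 'rV[R]_n -> set 'rV[R]_m) : Prop :=
  Om (n + m)%N [set z | exists x d, D x d /\ z = row_mx x d].

Definition definable_fun (R : realType)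
    (Om : forall p : nat, set (set 'rV[R]_p)) (n : nat)
    (h : 'rV[R]_n -> R) : Prop :=
  Om (n + 1)%N [set z | exists x, z = row_mx x (const_mx (h x))].

(* Main.v *)
(** Let [W_k] be the total weight with which the momentum [m_k] enters the steps from [k] up to the
    first exit. The shifted iterates [y_k = x_k - W_k m_k] satisfy [y_(k+1) = y_k - w_k g_k] with
    [0 <= w_k <= sup_j eta_j], however the step sizes vary, and stay close to [x_k].

    There is a level [r] above the values of [f] on [X0] that contains no critical point. If runs
    with arbitrarily small steps could climb from [r] to [r + 1], then an ultrafilter limit of
    them, started at the last time below [r], would be a Lipschitz curve [Y] with [f (Y 0) = r],
    [f (Y t) >= r] and [- Y' \in conv (D Y)] almost everywhere, whereas conservativity makes [f]
    strictly decrease along [Y] near the noncritical point [Y 0].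

    If every level above some [a] contained critical points, lexicographic minimization would
    choose one, [gam t], definably from each level [t]. On some interval the coordinates of [gam]
    are monotone and continuous, so [gam] becomes Lipschitz after a reparametrization, and
    conservativity shows that [f (gam t) = t] does not increase. *)

Require Import Defs.
From HB Require Import structures.
From mathcomp Require Import all_boot all_order all_algebra.
From mathcomp Require Import -(notations) mpoly.
From mathcomp Require Import all_classical all_reals all_analysis.
From mathcomp Require Import measurable_realfun ring lra.

Import Order.TTheory GRing.Theory Num.Theory.
Import numFieldNormedType.Exports.

Set Implicit Arguments.
Unset Strict Implicit.

Local Open Scope classical_set_scope.
Local Open Scope ring_scope.

(** The adaptive rule contributes the bound [0 <= eta_k <= alpha / sqrt eps0], its denominators
    being at least [sqrt eps0]. Before the first exit above [r + 1] the iterates stay in a bounded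
    set, so gradients and momenta share a bound [G], and uniform continuity gives the climb from [r]
    to [r + 1] a minimal duration that does not depend on the steps. Hence the limit curve lives on
    a nontrivial interval.

    Conservativity integrates the largest product with the field, so a single element of [D] with a
    large product bounds the growth of [f] from below. A decrease is therefore obtained as an
    increase along the time-reversed curve.

    Convex hulls are handled by duality: a half-space [dot l u >= c] containing [D] near a point
    contains convex combinations and their limits, whence [dot Y' u <= - c]. Taking for [u] a
    direction certifying noncriticality keeps [Y'] away from 0; taking [u = Y'] then produces an
    element of [D] itself whose product with [Y'] is negative. Criticality is phrased through
    directions too, which makes it first-order and directly usable along the reversed curve of
    critical points. *)

Section DistanceMinMax.
Context {R : realDomainType}.
Implicit Types a x y : R.

Lemma ler_dist_maxl a x y : `|Num.max x a - Num.max y a| <= `|x - y|.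
Proof.
rewrite ler_norml; have := ler_norm (x - y); have := ler_norm (- (x - y)).
by rewrite normrN; case: (leP x a) => ?; case: (leP y a) => ?; lra.
Qed.

Lemma ler_dist_maxr a x y : `|Num.max a x - Num.max a y| <= `|x - y|.
Proof. by rewrite !(maxC a) ler_dist_maxl. Qed.

Lemma ler_dist_minl a x y : `|Num.min x a - Num.min y a| <= `|x - y|.
Proof.
rewrite ler_norml; have := ler_norm (x - y); have := ler_norm (- (x - y)).
by rewrite normrN; case: (leP x a) => ?; case: (leP y a) => ?; lra.
Qed.

End DistanceMinMax.

(** * The Euclidean norm and its topology *)

Section EuclideanNorm.
Context {R : realType} {n : nat}.
Implicit Types (u v w : 'rV[R]_n) (a : R).

Lemma dotC u v : dot u v = dot v u.
Proof. by apply: eq_bigr => i _; rewrite mulrC. Qed.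

Lemma dotDr u v w : dot u (v + w) = dot u v + dot u w.
Proof. by rewrite -big_split/=; apply: eq_bigr => i _; rewrite mxE mulrDr. Qed.

Lemma dotZr u a v : dot u (a *: v) = a * dot u v.
Proof. by rewrite /dot mulr_sumr; apply: eq_bigr => i _; rewrite mxE mulrCA. Qed.

Lemma dotNr u v : dot u (- v) = - dot u v.
Proof. by rewrite -scaleN1r dotZr mulN1r. Qed.

Lemma dotBr u v w : dot u (v - w) = dot u v - dot u w.
Proof. by rewrite dotDr dotNr. Qed.

Lemma dot0r u : dot u 0 = 0.
Proof. by rewrite -(scale0r 0) dotZr mul0r. Qed.

Lemma dotDl u v w : dot (v + w) u = dot v u + dot w u.
Proof. by rewrite !(dotC _ u) dotDr. Qed.

Lemma dotZl u a v : dot (a *: v) u = a * dot v u.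
Proof. by rewrite !(dotC _ u) dotZr. Qed.

Lemma dotNl u v : dot (- v) u = - dot v u.
Proof. by rewrite !(dotC _ u) dotNr. Qed.

Lemma dot_ge0 u : 0 <= dot u u.
Proof. by apply: sumr_ge0 => i _; rewrite -expr2 sqr_ge0. Qed.

Lemma sqr_coord_le_dot u i : u 0 i ^+ 2 <= dot u u.
Proof.
rewrite /dot (bigD1 i)//= -expr2 lerDl.
by apply: sumr_ge0 => j _; rewrite -expr2 sqr_ge0.
Qed.

Lemma cauchy_schwarz u v : dot u v ^+ 2 <= dot u u * dot v v.
Proof.
have [v0|vN0] := eqVneq (dot v v) 0.
  suff -> : v = 0 by rewrite !dot0r mulr0 expr0n.
  apply/rowP => i; rewrite mxE; apply/eqP; rewrite -sqrf_eq0.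
  by rewrite eq_le sqr_ge0 andbT -v0 sqr_coord_le_dot.
have v0 : 0 < dot v v by rewrite lt_def vN0 dot_ge0.
have := dot_ge0 (dot v v *: u - dot u v *: v).
rewrite dotBr !dotZr !(dotC _ u) !(dotC _ v) !dotBr !dotZr (dotC v u).
have -> : dot v v * (dot v v * dot u u - dot u v * dot u v) -
  dot u v * (dot v v * dot u v - dot u v * dot v v) =
  dot v v * (dot u u * dot v v - dot u v ^+ 2) by ring.
by rewrite pmulr_rge0// subr_ge0.
Qed.

Lemma enorm_ge0 u : 0 <= enorm u.
Proof. exact: sqrtr_ge0. Qed.

Lemma sqr_enorm u : enorm u ^+ 2 = dot u u.
Proof. by rewrite sqr_sqrtr// dot_ge0. Qed.

Lemma enorm0 : enorm (0 : 'rV[R]_n) = 0.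
Proof. by rewrite /enorm dot0r sqrtr0. Qed.

Lemma enormZ a u : enorm (a *: u) = `|a| * enorm u.
Proof.
by rewrite /enorm dotZr dotZl mulrA -expr2 sqrtrM ?sqr_ge0// sqrtr_sqr.
Qed.

Lemma enormN u : enorm (- u) = enorm u.
Proof. by rewrite -scaleN1r enormZ normrN1 mul1r. Qed.

Lemma enormBC u v : enorm (u - v) = enorm (v - u).
Proof. by rewrite -enormN opprB. Qed.

Lemma dot_le_enorm u v : `|dot u v| <= enorm u * enorm v.
Proof.
rewrite -ler_sqr ?nnegrE ?mulr_ge0 ?enorm_ge0// exprMn !sqr_enorm.
by rewrite real_normK ?num_real// cauchy_schwarz.
Qed.

Lemma ler_enormD u v : enorm (u + v) <= enorm u + enorm v.
Proof.
rewrite -ler_sqr ?nnegrE ?addr_ge0 ?enorm_ge0// sqrrD !sqr_enorm.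
rewrite dotDr !dotDl (dotC v u).
have := le_trans (ler_norm _) (dot_le_enorm u v); lra.
Qed.

Lemma ler_enorm_distD w u v : enorm (u - v) <= enorm (u - w) + enorm (w - v).
Proof. by apply: le_trans (ler_enormD _ _); rewrite addrA subrK. Qed.

Lemma coord_le_enorm u i : `|u 0 i| <= enorm u.
Proof.
rewrite -ler_sqr ?nnegrE ?enorm_ge0// sqr_enorm real_normK ?num_real//.
exact: sqr_coord_le_dot.
Qed.

Lemma enorm_le_coord u a : (forall i, `|u 0 i| <= a) -> enorm u <= n%:R * a.
Proof.
move=> ua; have [n0|] := posnP n.
  rewrite /enorm /dot big1 ?sqrtr0 => [|i _]; first by rewrite n0 mul0r.
  by have := ltn_ord i; rewrite [X in (_ < X)%N]n0.
move=> n0.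
have a0 : 0 <= a by apply: le_trans (ua (Ordinal n0)).
rewrite -ler_sqr ?nnegrE ?mulr_ge0 ?enorm_ge0// sqr_enorm.
apply: (@le_trans _ _ (\sum_(i < n) a ^+ 2)).
  apply: ler_sum => i _; rewrite -expr2 -real_normK ?num_real//.
  by rewrite ler_sqr ?nnegrE.
rewrite sumr_const card_ord -[leLHS]mulr_natl exprMn ler_wpM2r ?sqr_ge0//.
by rewrite -natrX ler_nat -{1}(expn1 n) leq_pexp2l.
Qed.

Lemma norm_le_enorm u : `|u| <= enorm u.
Proof.
rewrite -[`|u|]/(mx_norm u) mx_normrE; apply: bigmax_le => [|i _]; first exact: enorm_ge0.
by rewrite ord1 coord_le_enorm.
Qed.

Lemma coord_le_norm u i : `|u 0 i| <= `|u|.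
Proof.
rewrite -[leRHS]/(mx_norm u) mx_normrE; apply: (le_trans _ (le_bigmax _ _ (0, i))).
exact: lexx.
Qed.

Lemma enorm_le_norm u : enorm u <= n%:R * `|u|.
Proof. by apply: enorm_le_coord => i; exact: coord_le_norm. Qed.

Lemma cvg_enormP T (F : set_system T) {FF : Filter F} (f : T -> 'rV[R]_n) u :
  f @ F --> u <-> forall e, 0 < e -> \forall x \near F, enorm (f x - u) <= e.
Proof.
split=> [fu e e0|fu].
  (* [n.+1] instead of [n] keeps the denominator positive when [n = 0]. *)
  have e1 : 0 < e / n.+1%:R by rewrite divr_gt0.
  have /cvgrPdist_le/(_ _ e1) := fu.
  apply: filterS => x; rewrite distrC => fux.
  apply: (le_trans (enorm_le_norm _)).
  apply: (@le_trans _ _ (n.+1%:R * (e / n.+1%:R))).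
    by apply: ler_pM => //; rewrite ler_nat.
  by rewrite mulrC divfK// pnatr_eq0.
apply/cvgrPdist_le => e e0; apply: filterS (fu e e0) => x.
by rewrite enormBC; apply: le_trans; exact: norm_le_enorm.
Qed.

Lemma cvg_dot T (F : set_system T) {FF : Filter F} (f : T -> 'rV[R]_n) u v :
  f @ F --> u -> dot v (f x) @[x --> F] --> dot v u.
Proof.
move=> fu.
have e1 e : 0 < e -> 0 < e / (1 + enorm v).
  by move=> ?; rewrite divr_gt0// ltr_wpDr// enorm_ge0.
apply/cvgrPdist_le => e e0.
apply: filterS (proj1 (cvg_enormP f u) fu _ (e1 _ e0)) => x fux.
rewrite -dotBr; apply: (le_trans (dot_le_enorm _ _)).
rewrite enormBC; apply: (@le_trans _ _ ((1 + enorm v) * (e / (1 + enorm v)))).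
  by apply: ler_pM => //; rewrite ?enorm_ge0// lerDr.
by rewrite mulrC divfK// gt_eqF// ltr_wpDr// enorm_ge0.
Qed.

Lemma nbhs_enormP u (U : set 'rV[R]_n) :
  nbhs u U <-> exists2 e, 0 < e & forall v, enorm (v - u) <= e -> U v.
Proof.
split=> [/nbhs_ballP[e /= e0 eU]|[e e0 eU]].
  exists (e / 2); first by rewrite divr_gt0.
  move=> v uv; apply: eU; rewrite -ball_normE/= distrC.
  apply: (le_lt_trans (norm_le_enorm _)); apply: (le_lt_trans uv).
  by rewrite ltr_pdivrMr// ltr_pMr// ltr1n.
have /(proj1 (cvg_enormP id u)) := @cvg_id _ (nbhs u).
by move=> /(_ _ e0); apply: filterS => v /eU.
Qed.

Lemma compact_enorm_le (A : set 'rV[R]_n) a : closed A ->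
  (forall u, A u -> enorm u <= a) -> compact A.
Proof.
move=> cA Aa; apply: bounded_closed_compact => //.
exists a; split; first exact: num_real.
move=> b ab u /Aa ua; apply: (le_trans (norm_le_enorm _)).
exact: le_trans ua (ltW ab).
Qed.

Lemma closed_enorm_le u a : closed [set v | enorm (v - u) <= a].
Proof.
move=> v clv; rewrite /=; apply/ler_addgt0Pr => e e0.
have [|w [/= wa wv]] := clv [set w | enorm (w - v) <= e].
  by apply/nbhs_enormP; exists e.
by apply: (le_trans (ler_enorm_distD w _ _)); rewrite enormBC addrC lerD.
Qed.

(** Compactness gives a cluster point, and an ultrafilter contains each set or its complement, which
    turns the cluster point into a limit. A single [U] thus serves all bounded sequences at once,
    with no passage to subsequences. *)
Lemma ultra_bounded_cvg (U : set_system nat) {UF : UltraFilter U}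
    (f : nat -> 'rV[R]_n) a :
  (forall k, enorm (f k) <= a) -> exists u, f @ U --> u.
Proof.
move=> fa.
have cA : compact [set v : 'rV[R]_n | enorm (v - 0) <= a].
  apply: (@compact_enorm_le _ a); first exact: closed_enorm_le.
  by move=> u /=; rewrite subr0.
have [|u [_ clu]] := cA (f @ U) _.
  by apply: nearW => k; rewrite /= subr0.
exists u => A uA.
have [//|UA] := in_ultra_setVsetC (f @^-1` A) UF.
by have [y []] := clu (~` A) A UA uA.
Qed.
End EuclideanNorm.

(** * Almost everywhere differentiability of Lipschitz functions *)

Section Rademacher.
Context {R : realType}.
Local Notation mu := (@lebesgue_measure R).

Lemma lebesgue_stieltjes_ocitv (G : cumulative R R) (a b : R) : a <= b ->
  lebesgue_stieltjes_measure G `]a, b] = (G b - G a)%:E.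
Proof.
move=> ab; rewrite -(@wlength_itv_bnd R G a b false false ab).
rewrite /lebesgue_stieltjes_measure /measure_extension/=.
by rewrite measurable_mu_extE//; exact: is_ocitv.
Qed.

(* The Stieltjes measures of [G] and [H] add up to Lebesgue measure, so that of [G] has a density. *)
Lemma lipschitz_cumulative_derivable_ae (G H : cumulative R R) (a b : R) :
  a < b -> (forall x, G x + H x = x) ->
  {ae mu, forall x, a < x < b -> derivable (G : R -> R) x 1}.
Proof.
move=> ab GH.
have idE A : measurable A -> mu A = (lebesgue_stieltjes_measure G A +
    lebesgue_stieltjes_measure H A)%E.
  move=> mA.
  pose GH' := measure_add (lebesgue_stieltjes_measure G) (lebesgue_stieltjes_measure H).
  transitivity (GH' A); last by rewrite /GH' measure_addE.
  apply: (@lebesgue_stieltjes_measure_unique R idfun) mA => X.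
  move=> /ocitvP[->|[[c d]/= cd ->]]; first by rewrite !measure0.
  rewrite (lebesgue_stieltjes_ocitv idfun (ltW cd)).
  transitivity (lebesgue_stieltjes_measure G `]c, d] +
    lebesgue_stieltjes_measure H `]c, d])%E; last by rewrite /GH' [RHS]measure_addE.
  rewrite (lebesgue_stieltjes_ocitv G (ltW cd)) (lebesgue_stieltjes_ocitv H (ltW cd)).
  rewrite -EFinD; congr EFin.
  by rewrite /= -[in LHS](GH c) -[in LHS](GH d); lra.
pose E := `]a, b]%classic : set (measurableTypeR R).
have mE : measurable E by exact: measurable_itv.
have Eoo : (lebesgue_stieltjes_measure G E < +oo)%E.
  by rewrite lebesgue_stieltjes_ocitv ?ltry// ltW.
(* Cut down to []a, b]] the Stieltjes measure is finite, and it is dominated by Lebesgue measure: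
   Radon-Nikodym gives the density, and [FTC1] differentiates its integral. *)
pose nu : {finite_measure set _ -> \bar R} := mfrestr mE Eoo.
have numu : nu `<< mu.
  apply/null_content_dominatesP => A mA muA0.
  apply/eqP; rewrite -measure_le0; apply: (@le_trans _ _ (lebesgue_stieltjes_measure G A)).
    by rewrite /nu/= /mfrestr /mrestr le_measure// inE//; exact: measurableI.
  have /= <- : mu A = 0%E := muA0.
  by rewrite (idE A mA) leeDl.
have [f [f0 ffin fint nuE]] := radon_nikodym_sigma_finite numu.
pose g x := fine (f x).
have gf x : (g x)%:E = f x by rewrite /g fineK.
have gint : mu.-integrable setT (EFin \o g).
  by apply: eq_integrable fint => // x _ /=; rewrite gf.
have gloc : locally_integrable setT g.
  have := integrable_locally (@measurableT _ _) gint; congr locally_integrable.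
  by apply/funext => y; rewrite patchE in_setT.
have gS y : mu.-integrable [set` Interval (BRight a) (BRight y)] (EFin \o g).
  by apply: integrableS gint => //; exact: measurable_itv.
have := FTC1 gS gloc.
apply: filterS; first exact: (ae_filter_ringOfSetsType mu).
move=> x + /andP[ax xb]; rewrite lte_fin => /(_ ax)[dF _].
apply: (@near_eq_derivable _ _ _
  (fun y => G a + \int[mu]_(t in [set` Interval (BRight a) (BRight y)]) g t)).
  near=> y.
  have ay : a < y by near: y; exact: lt_nbhsr.
  have yb : y < b by near: y; exact: lt_nbhsl.
  rewrite /Rintegral; under eq_integral do rewrite gf.
  rewrite -nuE//= /mfrestr /mrestr.
  rewrite (_ : _ `&` _ = `]a, y]%classic).
    by rewrite lebesgue_stieltjes_ocitv ?ltW//= addrC subrK.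
  rewrite setIidl// /E => z /=; rewrite !in_itv/= => /andP[-> /le_trans->] //.
  exact: ltW.
exact: derivableD (derivable_cst _ _ _) dF.
Unshelve. all: by end_near. Qed.

(** For a positive Lipschitz constant [K], both [(x + g x / K) / 2] and [(x - g x / K) / 2] are
    nondecreasing and continuous, and they add up to [x]; [g] is recovered linearly from the first
    one. *)
Lemma lipschitz_derivable_ae (g : R -> R) (L a b : R) :
  (forall x y, `|g x - g y| <= L * `|x - y|) ->
  {ae mu, forall x, a < x < b -> derivable g x 1}.
Proof.
move=> gL; have [ba|ab] := leP b a.
  by apply: aeW => x /andP[ax xb]; have := lt_trans ax xb; rewrite ltNge ba.
pose K : R := `|L| + 1; have K0 : 0 < K by rewrite ltr_wpDl.
have gK x y : `|g x - g y| <= K * `|x - y|.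
  by apply: (le_trans (gL x y)); rewrite ler_wpM2r// /K; have := ler_norm L; lra.
have key (s : R) : (s = 1 \/ s = -1) ->
    { G : cumulative R R | forall x, G x = (x + s * K^-1 * g x) / 2 }.
  move=> hs; pose F x := (x + s * K^-1 * g x) / 2.
  have sn x : `|s * x| = `|x| by case: hs => ->; rewrite ?mul1r ?mulN1r ?normrN.
  have gK' x y : `|s * K^-1 * g x - s * K^-1 * g y| <= `|x - y|.
    by rewrite -mulrBr -mulrA sn normrM gtr0_norm ?invr_gt0// ler_pdivrMl.
  have nd : nondecreasing F.
    move=> x y xy; rewrite /F ler_pM2r ?invr_gt0//.
    by have := gK' x y; rewrite ler_norml distrC (ger0_norm (_ : 0 <= y - x)) ?subr_ge0//; lra.
  have cF : continuous F.
    move=> x; apply: cvgMr_tmp.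
    apply: cvgD; first exact: cvg_id.
    apply: cvgMl_tmp; apply/cvgrPdist_le => e e0; near=> y.
    apply: (le_trans (gK _ _)); rewrite -ler_pdivlMl//.
    near: y; apply: cvgr_dist_le; first exact: cvg_id.
    by rewrite mulr_gt0// invr_gt0.
  exists (HB.pack_for (cumulative R R) F (isCumulative.Build R _ R F nd (right_continuousW cF))) => x.
  by [].
have [G GE] := key 1 (or_introl erefl); have [H HE] := key (-1) (or_intror erefl).
have GH x : G x + H x = x by rewrite GE HE; lra.
have := lipschitz_cumulative_derivable_ae ab GH.
apply: filterS; first exact: (ae_filter_ringOfSetsType mu).
move=> x /[apply] dG.
have -> : g = (fun y => (K * 2) *: G y - K *: y).
  apply/funext => y; rewrite GE /GRing.scale/=; field; exact: lt0r_neq0.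
by apply: derivableB; [exact: derivableZ|exact: derivableZ].
Unshelve. all: by end_near. Qed.

End Rademacher.

(** * Comparison of integrals without measurability *)

Section IntegralComparison.
Local Open Scope ereal_scope.
Context {d} {T : measurableType d} {R : realType}.
Variable mu : {measure set T -> \bar R}.
Import HBNNSimple.

(* The integrals are suprema over simple functions, so [f] and [g] need not be measurable. *)
Lemma ge0_le_integralD_indic (D N A : set T) (f g : T -> \bar R) (c : R) :
  measurable N -> mu N = 0 -> measurable A -> A `<=` D -> mu A < +oo ->
  (0 <= c)%R -> (forall x, 0 <= f x) -> (forall x, 0 <= g x) ->
  (forall x, D x -> ~ N x -> f x + (c * \1_A x)%:E <= g x) ->
  \int[mu]_(x in D) f x + c%:E * mu A <= \int[mu]_(x in D) g x.
Proof.
move=> mN N0 mA AD Aoo c0 f0 g0 fg.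
have cAfin : c%:E * mu A \is a fin_num.
  by rewrite fin_numM// ge0_fin_numE.
rewrite -leeBrDr// !ge0_integralE//; apply: ge_ereal_sup => _ [h /= hf <-].
rewrite leeBrDr//; apply: le_ereal_sup_tmp.
(* Raising a simple function below [f] by [c] on [A] gives one below [g] off [N]; setting it to zero
   on the null set [N] does not change its integral. *)
pose k := add_nnsfun h (scale_nnsfun (indic_nnsfun R mA) c0).
have mNC := measurableC mN.
exists (sintegral mu (proj_nnsfun k mNC)).
  exists (proj_nnsfun k mNC) => //= x.
  rewrite -[X in (X%:E <= _)%E]/((h x + c * \1_A x) * \1_(~` N) x)%R.
  have := hf x; rewrite !patchE [\1_(~` N) x]indicE.
  case: (boolP (x \in D)) => [/set_mem Dx hfx|/negP xD hx0].
    case: (boolP (x \in ~` N)) => [/set_mem Nx|_]; last by rewrite mulr0.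
    rewrite mulr1; apply: (le_trans _ (fg x Dx Nx)).
    by rewrite EFinD leeD.
  have -> : h x = 0%R by apply/eqP; rewrite eq_le -!lee_fin hx0 lee_fin fun_ge0.
  rewrite add0r indicE; case: (boolP (x \in A)) => [/set_mem/AD/mem_set//|_].
  by rewrite mulr0 mul0r.
have -> : sintegral mu (proj_nnsfun k mNC) = sintegral mu k.
  rewrite -!integralT_nnsfun; apply: ae_eq_integral => //.
  - by apply/measurable_EFinP.
  - by apply/measurable_EFinP.
  - exists N; split=> // x /= /not_implyP[_]; apply: contra_notP => Nx.
    rewrite -[LHS]/((k x * \1_(~` N) x)%R%:E).
    by rewrite indicE mem_set//= mulr1.
by rewrite sintegralD sintegralrM/= sintegral_indic.
Qed.

End IntegralComparison.

Section CurveIntegrals.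
Context {R : realType}.
Local Notation mu := (@lebesgue_measure R).

(** The positive parts differ by at least [c] on the second half and the negative parts are ordered,
    so each pair is compared separately. Finiteness of both integrals then allows the
    subtraction. *)
Lemma integral_half_jump (phi psi : R -> \bar R) (N : set R) (c p q : R) :
  mu.-negligible N -> 0 <= c ->
  (forall s, 0 <= s < 2^-1 -> psi s = phi s) ->
  (forall s, 2^-1 < s < 1 -> (phi s <= 0)%E) ->
  (forall s, 2^-1 < s < 1 -> ~ N s -> (c%:E <= psi s)%E) ->
  (\int[mu]_(s in `[0%R, 1%R]) phi s)%E = p%:E ->
  (\int[mu]_(s in `[0%R, 1%R]) psi s)%E = q%:E ->
  p + c / 2 <= q.
Proof.
move=> N0 c0 psiphi phi0 psic.
have set1_0 (x : R) : mu.-negligible [set x].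
  exists [set x]; split=> //; exact: lebesgue_measure_set1.
(* The points [2^-1] and [1], about which the hypotheses are silent, join the exceptional set. *)
have [M [mM M0 NM]] := negligibleU (negligibleU N0 (set1_0 2^-1)) (set1_0 1).
pose A : set R := `]2^-1, 1[%classic.
have muA : mu A = (2^-1)%:E.
  rewrite lebesgue_measure_itv/= lte_fin invf_lt1// ltr1n/= -EFinB; congr EFin; lra.
have Aoo : (mu A < +oo)%E by rewrite muA ltry.
have cut s : `[0, 1]%classic s -> ~ M s -> 0 <= s < 2^-1 \/ (2^-1 < s < 1 /\ ~ N s).
  rewrite /= in_itv/= => /andP[s0 s1] Ms.
  have [s2|s2] := ltP s 2^-1; [by left; rewrite s0|right; split].
    rewrite !lt_neqAle s2 s1 !andbT; apply/andP; split; apply/eqP => E; apply/Ms/NM.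
      by left; right.
    by right.
  by move=> ?; apply/Ms/NM; left; left.
have notA s : 0 <= s < 2^-1 -> \1_A s = 0 :> R.
  move=> /andP[_ s2]; rewrite indicE memNset// /A /= in_itv/= ltNge (ltW s2).
  by [].
rewrite integralE [in X in _ -> X -> _]integralE.
set P := (X in (X - _)%E = p%:E); set Q := (X in (_ - X)%E = p%:E).
set P' := (X in (X - _)%E = q%:E); set Q' := (X in (_ - X)%E = q%:E).
have PP' : (P + c%:E * mu A <= P')%E.
  apply: (@ge0_le_integralD_indic _ _ _ mu _ M) => //.
  - exact: measurable_itv.
  - by move=> s; rewrite /A /= !in_itv/= => /andP[h /ltW->]; rewrite (le_trans _ (ltW h)).
  - move=> s /cut/[apply] -[s2|[s2 Ns]].
      by rewrite notA// mulr0 adde0 !funeposE psiphi.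
    rewrite indicE mem_set /A/= ?in_itv// mulr1.
    rewrite {1}funeposE (max_idPr _) ?phi0// add0e.
    by rewrite !funeposE le_max psic.
have QQ' : (Q' <= Q)%E.
  have := @ge0_le_integralD_indic _ _ _ mu `[0, 1] M set0 psi^\-%E phi^\-%E 0.
  rewrite measure0 mul0e adde0; apply => //.
  move=> s /cut/[apply] -[s2|[s2 Ns]].
    by rewrite mul0r adde0 !funenegE psiphi.
  rewrite mul0r adde0 {1}funenegE (max_idPr _)//.
  by rewrite leeNl oppe0; apply: le_trans (psic s s2 Ns); rewrite lee_fin.
have P0 : (0 <= P)%E by apply: integral_ge0.
have Q0 : (0 <= Q)%E by apply: integral_ge0.
have P'0 : (0 <= P')%E by apply: integral_ge0.
have Q'0 : (0 <= Q')%E by apply: integral_ge0.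
move: P Q P' Q' P0 Q0 P'0 Q'0 PP' QQ' => [P| |] [Q| |] [P'| |] [Q'| |] //=.
rewrite muA -EFinM !lee_fin => P0 Q0 P'0 Q'0 PP' QQ' [<-] [<-]; lra.
Qed.

Lemma absolutely_continuous_lipschitz n (a b L : R) (gam : R -> 'rV[R]_n) :
  (forall s t, enorm (gam s - gam t) <= L * `|s - t|) ->
  absolutely_continuous_on a b gam.
Proof.
move=> gL e e0; pose K : R := `|L| + 1.
have K0 : 0 < K by rewrite ltr_wpDl.
exists (e / K) => [|N s t st _ stK]; first by rewrite divr_gt0.
apply: (@le_lt_trans _ _ (\sum_(i < N) K * (t i - s i))); last first.
  by rewrite -mulr_sumr -ltr_pdivlMl// mulrC.
apply: ler_sum => i _; apply: (le_trans (gL _ _)).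
have [_ [sti _]] := st i.
rewrite ger0_norm ?subr_ge0// ler_wpM2r ?subr_ge0// /K.
by have := ler_norm L; lra.
Qed.

Lemma lipschitz_curve_derivable_ae n (a b L : R) (gam : R -> 'rV[R]_n) :
  (forall s t, enorm (gam s - gam t) <= L * `|s - t|) ->
  {ae mu, forall s, a < s < b -> derivable gam s 1}.
Proof.
move=> gL.
have coordL i : {ae mu, forall s, a < s < b -> derivable (fun t => gam t 0 i) s 1}.
  apply: (@lipschitz_derivable_ae _ _ L) => s t; apply: le_trans (gL s t).
  by have := coord_le_enorm (gam s - gam t) i; rewrite !mxE.
have [] := @filter_forall _ _ _ _ (ae_filter_ringOfSetsType mu) coordL.
move=> N [mN N0 sN]; exists N; split=> //; apply: subset_trans sN => s /=.
apply: contra_not => h ab; apply/derivable_mxP => i j; rewrite ord1.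
exact: h.
Qed.

End CurveIntegrals.

(** * Conservative fields along Lipschitz curves *)

Section CurveDerivative.
Context {R : realType} {n : nat}.
Implicit Types (gam : R -> 'rV[R]_n) (l : 'rV[R]_n).

(** A first-order expansion in the Euclidean norm. Unlike the total function [derive1], it asserts
    that the derivative exists. *)
Definition has_velocity gam (s : R) l :=
  forall e, 0 < e -> exists2 d, 0 < d & forall h, `|h| <= d ->
    enorm (gam (s + h) - gam s - h *: l) <= e * `|h|.

Lemma has_velocityP gam s l :
  has_velocity gam s l <-> derivable gam s 1 /\ derive1 gam s = l.
Proof.
have eqn h : h != 0 ->
    enorm (h^-1 *: (gam (h + s) - gam s) - l) = enorm (gam (s + h) - gam s - h *: l) / `|h|.
  move=> h0; rewrite (addrC h) -[in RHS](scale1r (gam _ - _)) -(mulfV h0) -scalerA -scalerBr.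
  by rewrite enormZ mulrC mulrA mulVf ?mul1r// normr_eq0.
have -> : (derivable gam s 1 /\ derive1 gam s = l) <->
    h^-1 *: (gam (h + s) - gam s) @[h --> 0^'] --> l.
  have derE : derivable gam s 1 = cvg (h^-1 *: (gam (h + s) - gam s) @[h --> 0^']).
    rewrite /derivable; suff -> : (fun h => h^-1 *: ((gam \o shift s) (h *: 1) - gam s)) =
      (fun h => h^-1 *: (gam (h + s) - gam s)) by [].
    by apply/funext => h /=; rewrite /GRing.scale/= mulr1.
  rewrite derE /derive1; split=> [[dc <-]//|dl].
  by split; [apply/cvg_ex; exists l|exact: cvg_lim].
split=> [H|/cvg_enormP H e e0].
  apply/cvg_enormP => e e0; have [d d0 hd] := H e e0.
  have : \forall h \near (0 : R)^', `|h| <= d.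
    by apply/dnbhs0_le.
  apply: filterS2 (nbhs_dnbhs_neq 0) => h h0 /hd; rewrite eqn//.
  by rewrite ler_pdivrMr// normr_gt0.
have [d /= d0 hd] := H e e0.
exists (d / 2) => [|h hd2]; first by rewrite divr_gt0.
have [->|h0] := eqVneq h 0; first by rewrite addr0 subrr scale0r subr0 enorm0 normr0 mulr0.
have := hd h; rewrite /= eqn// ler_pdivrMr ?normr_gt0//; apply => //.
by rewrite sub0r normrN (le_lt_trans hd2)// ltr_pdivrMr// ltr_pMr// ltr1n.
Qed.

(** The chain rule read backwards: the velocity of a composite path [gam'] is known and that of its
    piece [gam] is wanted, whence the factor [a^-1] and an identity required only near [s]. *)
Lemma has_velocity_affine gam gam' (a b s r : R) (v l : 'rV[R]_n) :
  a != 0 -> 0 < r -> (forall h, `|h| <= r -> gam' (s + h) = gam (a * (s + h) + b) + v) ->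
  has_velocity gam' s l -> has_velocity gam (a * s + b) (a^-1 *: l).
Proof.
move=> a0 r0 gamE H e e0.
have na0 : 0 < `|a| by rewrite normr_gt0.
have [d d0 hd] := H (e * `|a|) (mulr_gt0 e0 na0).
exists (Num.min d r * `|a|) => [|h hle].
  by rewrite mulr_gt0// lt_min d0.
have : `|h / a| <= Num.min d r by rewrite normf_div ler_pdivrMr.
rewrite le_min => /andP[/hd + hr].
have := gamE 0; rewrite normr0 addr0 => /(_ (ltW r0)) ->; rewrite gamE//.
have -> : a * (s + h / a) + b = a * s + b + h by field.
have -> : e * `|a| * `|h / a| = e * `|h|.
  by rewrite normf_div -mulrA (mulrC `|a|) divfK// normr_eq0.
by rewrite opprD addrACA subrr addr0 scalerA.
Qed.

Lemma has_velocity_const gam (r s : R) v : 0 < r ->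
  (forall h, `|h| <= r -> gam (s + h) = v) -> has_velocity gam s 0.
Proof.
move=> r0 gamE e e0; exists r => // h hr.
have := gamE 0; rewrite normr0 addr0 => /(_ (ltW r0)) ->; rewrite gamE//.
by rewrite scaler0 subr0 subrr enorm0 mulr_ge0// ltW.
Qed.

End CurveDerivative.

Section ConservativeField.
Context {R : realType} {n : nat}.
Variables (D : 'rV[R]_n -> set 'rV[R]_n) (f : 'rV[R]_n -> R).

(** Otherwise there are points of the graph tending to [x] whose values have product with [u] at
    most [c + o(1)]; by local boundedness and closedness the values have a limit in [D x] with
    product at most [c]. *)
Lemma graph_closed_usc (x u : 'rV[R]_n) (c : R) :
  graph_closed D -> locally_bounded D ->
  (forall l, D x l -> c < dot l u) ->
  exists c' r, [/\ c < c', 0 < r & forall y l, enorm (y - x) <= r -> D y l -> c' <= dot l u].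
Proof.
move=> Dc Db xu; apply: contrapT => nousc.
have /choice[yl ylP] : forall k : nat, exists z : 'rV[R]_n * 'rV[R]_n,
    [/\ enorm (z.1 - x) <= k.+1%:R^-1, D z.1 z.2 & dot z.2 u <= c + k.+1%:R^-1].
  move=> k; apply: contrapT => noz; apply: nousc.
  exists (c + k.+1%:R^-1), k.+1%:R^-1; split; rewrite ?ltrDl ?invr_gt0//.
  move=> y l yx Dyl; rewrite leNgt; apply/negP => lu; apply: noz.
  by exists (y, l); split => //=; exact: ltW.
have cK : compact [set y : 'rV[R]_n | enorm (y - x) <= 1].
  apply: (@compact_enorm_le _ _ _ (1 + enorm x)); first exact: closed_enorm_le.
  by move=> y /= yx; rewrite -(subrK x y) (le_trans (ler_enormD _ _))// lerD2r.
have [M HM] := Db _ cK.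
have [U [UU oU]] := ultraFilterLemma eventually_filter.
have invU e : 0 < e -> \forall k \near U, k.+1%:R^-1 <= e :> R.
  move=> e0; apply/oU; have := near_infty_natSinv_lt (PosNum e0).
  by apply: filterS => k /= /ltW.
have yU : (fun k => (yl k).1) @ U --> x.
  apply/cvg_enormP => e /invU; apply: filterS => k ke.
  by have [h _ _] := ylP k; exact: le_trans ke.
have [l lU] : exists l : 'rV[R]_n, (fun k => (yl k).2) @ U --> l.
  apply: (@ultra_bounded_cvg _ _ U UU (fun k => (yl k).2) M) => k; have [h1 h2 _] := ylP k.
  by apply: HM h2; rewrite /= (le_trans h1)// invf_le1// ler1n.
have Dxl : D x l.
  have yUD : \forall k \near U, D (yl k).1 (yl k).2.
    by apply: nearW => k; have [] := ylP k.
  have ylU : yl @ U --> (x, l).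
    by apply: cvg_trans (cvg_pair yU lU); apply: near_eq_cvg; near=> k; case: (yl k).
  exact: (@closed_cvg _ _ U _ yl _ Dc yUD _ ylU).
suff : dot l u <= c by rewrite leNgt xu.
apply/ler_addgt0Pr => e e0; have e20 : 0 < e / 2 by rewrite divr_gt0.
have dU : dot u (yl k).2 @[k --> U] --> dot u l by exact: cvg_dot.
have /cvgrPdist_le/(_ _ e20) := dU.
move=> /filterI/(_ (invU _ e20))/filter_ex[k [/= h1 h2]].
have [_ _ ] := ylP k; rewrite dotC => h3.
have := ler_norm (dot u l - dot u (yl k).2); rewrite (dotC l u).
by have := le_trans h3 (lerD (lexx c) h2); lra.
Unshelve. all: by end_near. Qed.

Hypothesis conservative : conservative_field D f.

(* Compare the path [0 -> gam 0 -> stay there] with the path [0 -> gam 0] followed by [gam]. *)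
Lemma conservative_curve_increase (gam : R -> 'rV[R]_n) (L c : R) :
  0 <= c -> (forall s t, enorm (gam s - gam t) <= L * `|s - t|) ->
  (forall s l, 0 < s < 1 -> has_velocity gam s l ->
     exists2 d, D (gam s) d & c <= dot d l) ->
  f (gam 0) + c <= f (gam 1).
Proof.
move=> c0 gamL gamD.
(* Clipped clocks: [r1] runs on the first half and then rests at 1, [r2] rests at 0 and runs on the
   second half. Clipping keeps the paths Lipschitz across the junction. *)
pose r1 (s : R) := Num.min (2 * s) 1; pose r2 (s : R) := Num.max (2 * s - 1) 0.
pose path1 s := r1 s *: gam 0; pose path2 s := path1 s + (gam (r2 s) - gam 0).
have r1L s t : `|r1 s - r1 t| <= 2 * `|s - t|.
  by apply: (le_trans (ler_dist_minl _ _ _)); rewrite -mulrBr normrM ger0_norm.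
have r2L s t : `|r2 s - r2 t| <= 2 * `|s - t|.
  apply: (le_trans (ler_dist_maxl _ _ _)); rewrite (_ : _ - _ = 2 * (s - t)); last by ring.
  by rewrite normrM ger0_norm.
have path1L s t : enorm (path1 s - path1 t) <= (2 * enorm (gam 0)) * `|s - t|.
  by rewrite -scalerBl enormZ mulrAC ler_wpM2r ?enorm_ge0.
have path2L s t : enorm (path2 s - path2 t) <= (2 * enorm (gam 0) + `|L| * 2) * `|s - t|.
  rewrite /path2 opprD addrACA opprB [X in _ + X]addrA subrK mulrDl.
  apply: (le_trans (ler_enormD _ _)); rewrite lerD//.
  apply: (le_trans (gamL _ _)); rewrite -mulrA.
  by rewrite (le_trans (ler_wpM2r _ (ler_norm L)))// ler_wpM2l.
have [p0 p1] : path1 0 = 0 /\ path1 1 = gam 0.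
  rewrite /path1 /r1 mulr0 mulr1 (min_idPl _) ?ler01// (min_idPr _) ?ler1n//.
  by rewrite scale0r scale1r.
have [q0 q1] : path2 0 = 0 /\ path2 1 = gam 1.
  have h0 : r2 0 = 0 by rewrite /r2 mulr0 (max_idPr _)//; lra.
  have h1 : r2 1 = 1 by rewrite /r2 (max_idPl _); lra.
  by rewrite /path2 p0 p1 h0 h1 subrr addr0 addrC subrK.
have E1 := conservative_integral conservative (absolutely_continuous_lipschitz _ _ path1L) p0 p1.
have E2 := conservative_integral conservative (absolutely_continuous_lipschitz _ _ path2L) q0 q1.
have fin_of (x a : R) (I : \bar R) : x%:E = (a%:E + I)%E -> I = (x - a)%:E.
  by case: I => [z| |] //= [->]; rewrite addrC addrK.
have {}E1 := fin_of _ _ _ E1; have {}E2 := fin_of _ _ _ E2.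
have [N N0 sN] : exists2 N : set R, (@lebesgue_measure R).-negligible N &
    forall s, 0 < s < 1 -> ~ N s -> derivable path2 s 1.
  exists (~` [set s | 0 < s < 1 -> derivable path2 s 1]).
    exact: lipschitz_curve_derivable_ae path2L.
  by move=> s s01 /contrapT; apply.
(* Running through [gam] in half the time doubles the velocity: the gain is [2 * c] on an interval
   of length one half. *)
have c20 : 0 <= 2 * c by rewrite mulr_ge0.
suff: f (gam 0) - f 0 + 2 * c / 2 <= f (gam 1) - f 0 by lra.
apply: (integral_half_jump N0 c20 _ _ _ E1 E2) => [s /andP[s0 s2]|s /andP[s2 s1]|s s21 Ns].
- have near12 : \forall t \near s, path2 t = path1 t.
    near=> t; rewrite /path2 /r2 (max_idPr _) ?subrr ?addr0//.
    have : t < 2^-1 by near: t; exact: lt_nbhsl.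
    lra.
  have der12 : derive1 path2 s = derive1 path1 s.
    by rewrite !derive1E; exact: near_eq_derive near12.
  by rewrite (nbhs_singleton near12) der12.
- apply: ge_ereal_sup => _ [l _ <-].
  suff /has_velocityP[_ ->] : has_velocity path1 s 0 by rewrite dot0r.
  apply: (@has_velocity_const _ _ _ (s - 2^-1) _ (gam 0)); first by rewrite subr_gt0.
  move=> h; rewrite ler_norml /path1 /r1 => /andP[h1 h2].
  by rewrite (min_idPr _) ?scale1r//; lra.
- have s01 : 0 < s < 1 by lra.
  have vel := conj (sN s s01 Ns) (erefl (derive1 path2 s)).
  move/has_velocityP in vel.
  have r0 : 0 < s - 2^-1 by lra.
  have eqh h : `|h| <= s - 2^-1 -> path2 (s + h) = gam (2 * (s + h) + - 1) + 0.
    rewrite ler_norml addr0 /path2 /path1 /r1 /r2 => /andP[h1 h2].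
    by rewrite (min_idPr _) ?(max_idPl _) ?scale1r 1?addrC ?subrK//; lra.
  have two0 : (2 : R) != 0 by rewrite pnatr_eq0.
  have vel2 := has_velocity_affine two0 r0 eqh vel.
  have [|d dD] := gamD (2 * s - 1) _ _ vel2; first by lra.
  rewrite dotZr mulrC ler_pdivlMr// mulrC => cd.
  apply: le_ereal_sup_tmp; exists (dot d (derive1 path2 s))%:E; last by rewrite lee_fin.
  have E : path2 s = gam (2 * s - 1).
    by have := eqh 0; rewrite normr0 !addr0; apply; exact: ltW.
  by exists d; rewrite ?E.
Unshelve. all: by end_near. Qed.

End ConservativeField.

(** * Convex hulls and discrete trajectories *)

Section ConvexHull.
Context {R : realType} {n : nat}.

Lemma conv_hull_sub (A B : set 'rV[R]_n) :
  (forall x y t, 0 <= t <= 1 -> B x -> B y -> B (t *: x + (1 - t) *: y)) ->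
  A `<=` B -> conv_hull A `<=` B.
Proof.
move=> cB AB; apply: smallest_sub => // x y t; rewrite !inE => Bx By.
by apply: cB => //; apply/andP; split.
Qed.

Lemma conv_hull_dot_ge (A : set 'rV[R]_n) u c g :
  (forall l, A l -> c <= dot l u) -> conv_hull A g -> c <= dot g u.
Proof.
move=> Au; apply: (conv_hull_sub (B := [set g | c <= dot g u])) => //= x y t.
move=> /andP[t0 t1] cx cy; rewrite dotDl !dotZl.
have -> : c = t * c + (1 - t) * c by ring.
by rewrite lerD// ler_wpM2l// subr_ge0.
Qed.

Lemma conv_hull_enorm_le (A : set 'rV[R]_n) c g :
  (forall l, A l -> enorm l <= c) -> conv_hull A g -> enorm g <= c.
Proof.
move=> Au; apply: (conv_hull_sub (B := [set g | enorm g <= c])) => //= x y t.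
move=> /andP[t0 t1] cx cy; apply: (le_trans (ler_enormD _ _)).
rewrite !enormZ !ger0_norm ?subr_ge0//.
have -> : c = t * c + (1 - t) * c by ring.
by rewrite lerD// ler_wpM2l// subr_ge0.
Qed.

End ConvexHull.

Section Trajectory.
Context {R : realType} {n : nat}.
Variables (y g : nat -> 'rV[R]_n) (w : nat -> R) (N : nat) (d G : R).
Hypothesis w_bnd : forall k, (k < N)%N -> 0 <= w k <= d.
Hypothesis g_bnd : forall k, (k < N)%N -> enorm (g k) <= G.
Hypothesis yS : forall k, (k < N)%N -> y k.+1 = y k - w k *: g k.

(** Step sizes are read as durations: the iterates sample, at the times [elapsed w k], a curve of
    speed at most [G] moving against the field. *)
Definition elapsed (w : nat -> R) k := \sum_(i < k) w i.

Lemma elapsedS k : elapsed w k.+1 = elapsed w k + w k.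
Proof. by rewrite /elapsed big_ord_recr. Qed.

Lemma elapsed0 : elapsed w 0 = 0.
Proof. by rewrite /elapsed big_ord0. Qed.

Lemma elapsed_le k k' : (k <= k' <= N)%N -> elapsed w k <= elapsed w k'.
Proof.
move=> /andP[]; elim: k' => [|k' IH]; first by rewrite leqn0 => /eqP->.
rewrite leq_eqVlt => /predU1P[->//|]; rewrite ltnS => kk' k'N.
rewrite elapsedS (le_trans (IH kk' (ltnW k'N)))// lerDl.
by have /andP[] := w_bnd k'N.
Qed.

Lemma elapsed_dist k k' : (k <= k' <= N)%N ->
  enorm (y k' - y k) <= G * (elapsed w k' - elapsed w k).
Proof.
move=> /andP[]; elim: k' => [|k' IH].
  by rewrite leqn0 => /eqP-> _; rewrite !subrr enorm0 mulr0.
rewrite leq_eqVlt => /predU1P[->//|]; first by rewrite !subrr enorm0 mulr0.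
rewrite ltnS => kk' k'N; rewrite yS// addrAC elapsedS.
apply: (le_trans (ler_enormD _ _)).
rewrite enormN enormZ addrAC mulrDr lerD ?(IH kk' (ltnW k'N))//.
have /andP[w0 _] := w_bnd k'N.
by rewrite ger0_norm// mulrC ler_wpM2r// g_bnd.
Qed.

Lemma elapsed_norm_dist k k' : (k <= N)%N -> (k' <= N)%N ->
  enorm (y k' - y k) <= G * `|elapsed w k' - elapsed w k|.
Proof.
move=> kN k'N; have [kk'|/ltnW k'k] := leqP k k'.
  rewrite ger0_norm; first by apply: elapsed_dist; rewrite kk'.
  by rewrite subr_ge0 elapsed_le ?kk'.
rewrite enormBC distrC ger0_norm; first by apply: elapsed_dist; rewrite k'k.
by rewrite subr_ge0 elapsed_le ?k'k.
Qed.

Lemma elapsed_descent k k' u c : (k <= k' <= N)%N ->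
  (forall i, (k <= i < k')%N -> c <= dot (g i) u) ->
  dot (y k' - y k) u <= - c * (elapsed w k' - elapsed w k).
Proof.
move=> /andP[]; elim: k' => [|k' IH].
  by rewrite leqn0 => /eqP-> _ _; rewrite !subrr mulr0 dotC dot0r.
rewrite leq_eqVlt => /predU1P[-> _ _|]; first by rewrite !subrr mulr0 dotC dot0r.
rewrite ltnS => kk' k'N cg.
have {}IH : dot (y k' - y k) u <= - c * (elapsed w k' - elapsed w k).
  by apply: IH (ltnW k'N) _ => // i /andP[ki ik']; rewrite cg// ki ltnS ltnW.
rewrite yS// addrAC elapsedS dotDl dotNl dotZl.
have := cg k'; rewrite kk' ltnSn => /(_ isT) ck'.
have /andP[w0 _] := w_bnd k'N.
by have := ler_wpM2l w0 ck'; lra.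
Qed.

(** The last index not later than [t] works, since one more step of length at most [d] passes [t].
    Time 0 is treated apart: steps may vanish, so later indices could also have elapsed time 0,
    while the starting position is the one whose level is controlled. *)
Lemma elapsed_index t T : 0 <= t <= T -> T <= elapsed w N -> 0 <= d ->
  exists k, [/\ (k <= N)%N, `|elapsed w k - t| <= d & t = 0 -> k = 0%N].
Proof.
move=> /andP[t0 tT] TN d0; have [->|tN0] := eqVneq t 0.
  by exists 0%N; rewrite elapsed0 subrr normr0.
pose P k := (k <= N)%N && (elapsed w k <= t).
have P0 : exists k, P k by exists 0%N; rewrite /P elapsed0.
have PN k : P k -> (k <= N)%N by case/andP.
case: (ex_maxnP P0 PN) => k /andP[kN kt] kmax.
exists k; split=> // [|t0']; last by rewrite t0' eqxx in tN0.
rewrite distrC ger0_norm ?subr_ge0// lerBlDl.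
have [kN'|] := ltnP k N; last first.
  move=> Nk; have kE : k = N by apply/eqP; rewrite eqn_leq kN Nk.
  by rewrite kE -(addr0 t) lerD// (le_trans tT).
have : ~~ P k.+1 by apply/negP => /kmax; rewrite ltnn.
rewrite /P kN'/= -ltNge elapsedS => /ltW/le_trans; apply; rewrite lerD2l.
by have /andP[] := w_bnd kN'.
Qed.

End Trajectory.

(** * Limits of discrete runs *)

Section NoEscape.
Context {R : realType} {n : nat}.
Variables (D : 'rV[R]_n -> set 'rV[R]_n) (f : 'rV[R]_n -> R).

(* [run_pos] are the positions that get updated, [run_query] the nearby points at which the field
   is evaluated. *)
Record run := Run {
  run_pos : nat -> 'rV[R]_n ;
  run_query : nat -> 'rV[R]_n ;
  run_grad : nat -> 'rV[R]_n ;
  run_step : nat -> R ;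
  run_len : nat }.

(** The same [d] bounds the steps and the distance from position to query: as it tends to 0, the
    limit curve is driven by the field at its own position. The duration [T] stays fixed. *)
Definition escaping (r T G d : R) (z : run) : Prop :=
  [/\ f (run_pos z 0%N) <= r,
      forall k, (0 < k <= run_len z)%N -> r <= f (run_pos z k),
      T <= elapsed (run_step z) (run_len z) &
      forall k, (k < run_len z)%N ->
        [/\ 0 <= run_step z k <= d, enorm (run_grad z k) <= G,
            enorm (run_query z k - run_pos z k) <= d,
            conv_hull (D (run_query z k)) (run_grad z k) &
            run_pos z k.+1 = run_pos z k - run_step z k *: run_grad z k] ].

Section Limit.
Variables (r T G B : R) (z : nat -> run) (U : set_system nat).
Context {UU : UltraFilter U}.
Hypothesis oU : \oo `<=` U.
Hypothesis fB : forall x, f x <= r -> enorm x <= B.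
Hypothesis G0 : 0 <= G.
Hypothesis zesc : forall j, escaping r T G j.+1%:R^-1 (z j).

Lemma ultra_natSinv_le e : 0 < e -> \forall k \near U, k.+1%:R^-1 <= e :> R.
Proof.
move=> e0; apply/oU; have := near_infty_natSinv_lt (PosNum e0).
by apply: filterS => k /= /ltW.
Qed.

Lemma ultra_cvg_le (u : nat -> 'rV[R]_n) (x : 'rV[R]_n) (e : R) : u @ U --> x -> 0 < e ->
  \forall j \near U, enorm (u j - x) <= e.
Proof. by move=> /cvg_enormP; apply. Qed.

Lemma ultra_ex3 (P Q S : set nat) : U P -> U Q -> U S ->
  exists j, [/\ P j, Q j & S j].
Proof.
by move=> hP hQ hS; have [j [? []]] := filter_ex (filterI hP (filterI hQ hS)); exists j.
Qed.

Lemma limit_curve_exists : exists (idx : R -> nat -> nat) (Y : R -> 'rV[R]_n),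
  forall t, 0 <= t <= T ->
   [/\ forall j, (idx t j <= run_len (z j))%N,
       forall j, `|elapsed (run_step (z j)) (idx t j) - t| <= j.+1%:R^-1,
       t = 0 -> forall j, idx t j = 0%N &
       run_pos (z j) (idx t j) @[j --> U] --> Y t].
Proof.
have /choice[idx idxP] : forall t, exists i : nat -> nat, 0 <= t <= T ->
   [/\ forall j, (i j <= run_len (z j))%N,
       forall j, `|elapsed (run_step (z j)) (i j) - t| <= j.+1%:R^-1 &
       t = 0 -> forall j, i j = 0%N].
  move=> t; have [tT|] := boolP (0 <= t <= T); last by exists (fun=> 0%N).
  have /choice[i iP] : forall j, exists k, [/\ (k <= run_len (z j))%N,
     `|elapsed (run_step (z j)) k - t| <= j.+1%:R^-1 & t = 0 -> k = 0%N].
    move=> j; have [_ _ Tj zj] := zesc j.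
    by apply: elapsed_index tT Tj _ => // k /zj[].
  by exists i => _; split=> [j|j|t0 j]; have [h1 h2 h3] := iP j => //; exact: h3.
have /choice[Y YP] : forall t, exists Yt : 'rV[R]_n, 0 <= t <= T ->
    run_pos (z j) (idx t j) @[j --> U] --> Yt.
  move=> t; have [tT|] := boolP (0 <= t <= T); last by exists 0.
  have [h1 h2 h3] := idxP t tT.
  (* The run starts in the ball of radius [B] and moves with speed at most [G] for a time at most
     [T + 1]. *)
  have [|x xP] := @ultra_bounded_cvg _ _ U UU
      (fun j => run_pos (z j) (idx t j)) (B + G * (T + 1)); last by exists x.
  move=> j; have [f0 _ _ zj] := zesc j.
  rewrite -(subrK (run_pos (z j) 0%N) (run_pos (z j) (idx t j))) addrC.
  apply: (le_trans (ler_enormD _ _)); rewrite lerD ?fB//.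
  have wP k : (k < run_len (z j))%N -> 0 <= run_step (z j) k <= j.+1%:R^-1 by move=> /zj[].
  have gP k : (k < run_len (z j))%N -> enorm (run_grad (z j) k) <= G by move=> /zj[].
  have yP k : (k < run_len (z j))%N ->
    run_pos (z j) k.+1 = run_pos (z j) k - run_step (z j) k *: run_grad (z j) k by move=> /zj[].
  have := elapsed_dist wP gP yP (k := 0%N) (k' := idx t j).
  rewrite leq0n h1 => /(_ isT)/le_trans; apply; rewrite ler_wpM2l// elapsed0 subr0.
  have := ler_norm (elapsed (run_step (z j)) (idx t j) - t).
  have j1 : j.+1%:R^-1 <= 1 :> R by rewrite invf_le1// ler1n.
  by have := le_trans (h2 j) j1; move: tT; lra.
exists idx, Y => t tT; have [h1 h2 h3] := idxP t tT.
by split=> //; exact: YP.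
Qed.

Section Curve.
Variables (idx : R -> nat -> nat) (Y : R -> 'rV[R]_n).
Hypothesis YP : forall t, 0 <= t <= T ->
   [/\ forall j, (idx t j <= run_len (z j))%N,
       forall j, `|elapsed (run_step (z j)) (idx t j) - t| <= j.+1%:R^-1,
       t = 0 -> forall j, idx t j = 0%N &
       run_pos (z j) (idx t j) @[j --> U] --> Y t].

Lemma limit_curve_lipschitz s t : 0 <= s <= T -> 0 <= t <= T ->
  enorm (Y s - Y t) <= G * `|s - t|.
Proof.
move=> sT tT; apply/ler_addgt0Pr => e e0.
(* Each of the two ends costs [e1] in position and [e1] in time, the latter worth [G * e1]; the
   total is [e]. *)
pose e1 : R := e / (2 * (1 + G)).
have G1 : 0 < 1 + G by rewrite ltr_wpDr.
have e10 : 0 < e1 by rewrite divr_gt0// mulr_gt0.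
have [s1 s2 _ s4] := YP sT; have [t1 t2 _ t4] := YP tT.
have [j [/= sj tj je]] :=
  ultra_ex3 (ultra_cvg_le s4 e10) (ultra_cvg_le t4 e10) (ultra_natSinv_le e10).
have [_ _ _ zj] := zesc j.
have wP k : (k < run_len (z j))%N -> 0 <= run_step (z j) k <= j.+1%:R^-1 by move=> /zj[].
have gP k : (k < run_len (z j))%N -> enorm (run_grad (z j) k) <= G by move=> /zj[].
have yP k : (k < run_len (z j))%N ->
  run_pos (z j) k.+1 = run_pos (z j) k - run_step (z j) k *: run_grad (z j) k by move=> /zj[].
have H := elapsed_norm_dist wP gP yP (t1 j) (s1 j).
set ps := run_pos (z j) (idx s j) in sj H.
set pt := run_pos (z j) (idx t j) in tj H.
have H2 : enorm (ps - pt) <= G * (`|s - t| + 2 * e1).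
  apply: (le_trans H); rewrite ler_wpM2l//.
  have := le_trans (s2 j) je; have := le_trans (t2 j) je.
  set a := elapsed _ _; set b := elapsed _ _ => a1 b1.
  apply: (@le_trans _ _ (`|b - s| + `|s - t| + `|t - a|)).
    by rewrite (_ : b - a = b - s + (s - t) + (t - a)) ?(le_trans (ler_normD _ _))// ?lerD2r ?ler_normD//; ring.
  by rewrite (distrC t); lra.
have := ler_enorm_distD ps (Y s) (Y t); have := ler_enorm_distD pt ps (Y t).
rewrite (enormBC (Y s) ps) => a1 a2.
have e2 : e1 * (2 * (1 + G)) = e by rewrite /e1 divfK// gt_eqF// mulr_gt0.
lra.
Qed.

(** The dual, integrated form of [- Y' \in conv (D Y)]: each step of a late run taken near [Y t]
    uses a convex combination of values of [D] in the half-space [dot l u >= c], and the sum of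
    these steps passes to the limit. *)
Lemma limit_curve_inclusion t h u c rho : 0 <= t -> 0 < h -> t + h <= T -> 0 < rho ->
  (forall x l, enorm (x - Y t) <= rho -> D x l -> c <= dot l u) ->
  G * h <= rho / 4 -> dot (Y (t + h) - Y t) u <= - c * h.
Proof.
move=> t0 h0 thT rho0 DY Ghr.
have tT : 0 <= t <= T by lra.
have htT : 0 <= t + h <= T by lra.
apply/ler_addgt0Pr => e e0.
pose M : R := 1 + 2 * `|c| + 2 * enorm u.
have M0 : 0 < M by rewrite /M; have := enorm_ge0 u; have := normr_ge0 c; lra.
have [s1 s2 _ s4] := YP htT; have [t1 t2 _ t4] := YP tT.
pose e1 : R := Num.min (e / M) (Num.min (h / 4) (rho / (4 * (1 + G)))).
have G1 : 0 < 1 + G by rewrite ltr_wpDr.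
have e10 : 0 < e1.
  by rewrite /e1 !lt_min !divr_gt0// mulr_gt0.
have [j [/= sj tj je]] :=
  ultra_ex3 (ultra_cvg_le s4 e10) (ultra_cvg_le t4 e10) (ultra_natSinv_le e10).
have eM : M * e1 <= e by rewrite mulrC -ler_pdivlMr// /e1 ge_min lexx.
have eh : e1 <= h / 4 by rewrite /e1 !ge_min lexx orbT.
have erho : (1 + G) * e1 <= rho / 4.
  rewrite mulrC -ler_pdivlMr// /e1 !ge_min; apply/orP; right; apply/orP; right.
  by rewrite invfM mulrA.
have [_ _ _ zj] := zesc j.
have wP k : (k < run_len (z j))%N -> 0 <= run_step (z j) k <= j.+1%:R^-1 by move=> /zj[].
have gP k : (k < run_len (z j))%N -> enorm (run_grad (z j) k) <= G by move=> /zj[].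
have yP k : (k < run_len (z j))%N ->
  run_pos (z j) k.+1 = run_pos (z j) k - run_step (z j) k *: run_grad (z j) k by move=> /zj[].
have ta := le_trans (t2 j) je; have sa := le_trans (s2 j) je.
move: (t1 j) (s1 j) tj sj ta sa; set k := idx t j; set k' := idx (t + h) j => kN k'N tj sj.
rewrite !ler_norml => /andP[ta1 ta2] /andP[sa1 sa2].
have kk' : (k <= k')%N.
  rewrite leqNgt; apply/negP => k'k.
  have := elapsed_le wP (k := k') (k' := k); rewrite ltnW//= kN => /(_ isT); lra.
have H : dot (run_pos (z j) k' - run_pos (z j) k) u <=
    - c * (elapsed (run_step (z j)) k' - elapsed (run_step (z j)) k).
  apply: (elapsed_descent wP yP); first by rewrite kk'.
  move=> i /andP[ki ik'].
  have iN : (i < run_len (z j))%N by exact: leq_trans k'N.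
  have [_ _ xi gi _] := zj i iN.
  apply: conv_hull_dot_ge gi => l; apply: DY.
  have d1 : enorm (run_pos (z j) i - run_pos (z j) k) <= G * (h + 2 * e1).
    have := elapsed_dist wP gP yP (k := k) (k' := i); rewrite ki (ltnW iN) => /(_ isT).
    move=> /le_trans; apply; rewrite ler_wpM2l//.
    have := elapsed_le wP (k := i) (k' := k'); rewrite (ltnW ik') k'N => /(_ isT); lra.
  have := ler_enorm_distD (run_pos (z j) i) (run_query (z j) i) (Y t).
  have := ler_enorm_distD (run_pos (z j) k) (run_pos (z j) i) (Y t).
  have := le_trans xi je.
  have Ge : 0 <= G * e1 by rewrite mulr_ge0// ltW.
  lra.
have cS : - c * (elapsed (run_step (z j)) k' - elapsed (run_step (z j)) k) <= - c * h + `|c| * (2 * e1).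
  rewrite -lerBlDl -mulrBr; apply: (le_trans (ler_norm _)); rewrite normrM normrN ler_wpM2l//.
  by rewrite ler_norml; apply/andP; split; lra.
have split3 : Y (t + h) - Y t = (run_pos (z j) k' - run_pos (z j) k)
   + (Y (t + h) - run_pos (z j) k') + (run_pos (z j) k - Y t).
  by rewrite [X in _ = X + _]addrC !addrA !subrK.
rewrite split3 dotDl dotDl.
have := le_trans (ler_norm _) (dot_le_enorm (Y (t + h) - run_pos (z j) k') u).
have := le_trans (ler_norm _) (dot_le_enorm (run_pos (z j) k - Y t) u).
rewrite (enormBC (Y (t + h))).
have := ler_wpM2r (enorm_ge0 u) sj; have := ler_wpM2r (enorm_ge0 u) tj.
move: eM; rewrite /M; lra.
Qed.


Lemma limit_curve_velocity s l u c rho : 0 < s < T -> 0 < rho ->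
  has_velocity Y s l ->
  (forall x d, enorm (x - Y s) <= rho -> D x d -> c <= dot d u) ->
  dot l u <= - c.
Proof.
move=> /andP[s0 sT] rho0 vel DY; apply/ler_addgt0Pr => e e0.
have e10 : 0 < e / (1 + enorm u) by rewrite divr_gt0// ltr_wpDr ?enorm_ge0.
have [d d0 hd] := vel _ e10.
have G1 : 0 < 1 + G by rewrite ltr_wpDr.
pose h := Num.min d (Num.min (T - s) (rho / (4 * (1 + G)))).
have h0 : 0 < h by rewrite !lt_min d0 subr_gt0 sT divr_gt0// mulr_gt0.
have hT : s + h <= T by rewrite -lerBrDl !ge_min lexx orbT.
have hrho : (1 + G) * h <= rho / 4.
  rewrite mulrC -ler_pdivlMr// /h !ge_min; apply/orP; right; apply/orP; right.
  by rewrite invfM mulrA.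
have Gh : G * h <= rho / 4 by move: hrho; rewrite mulrDl mul1r; lra.
have H := limit_curve_inclusion (ltW s0) h0 hT rho0 DY Gh.
have hdle : `|h| <= d by rewrite gtr0_norm// !ge_min lexx.
have := le_trans (ler_norm _) (dot_le_enorm (h *: l - (Y (s + h) - Y s)) u).
rewrite enormBC => /le_trans/(_ (ler_wpM2r (enorm_ge0 u) (hd h hdle))).
rewrite gtr0_norm// dotDl dotNl dotZl => H2.
have H3 : e / (1 + enorm u) * enorm u <= e.
  rewrite mulrAC ler_pdivrMr ?ltr_wpDr ?enorm_ge0//.
  by rewrite mulrDr mulr1 lerDr ltW.
have := ler_wpM2l (ltW h0) H3; rewrite mulrA (mulrC h (e / _)) => H4.
by rewrite -(ler_pM2l h0); lra.
Qed.

End Curve.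
End Limit.
End NoEscape.

Section NoEscapeConclusion.
Context {R : realType} {n : nat}.
Variables (D : 'rV[R]_n -> set 'rV[R]_n) (f : 'rV[R]_n -> R).

Lemma no_escape (r T G B : R) :
  conservative_field D f -> continuous f ->
  (forall x, f x <= r -> enorm x <= B) ->
  (forall x, f x = r -> exists v, forall l, D x l -> 0 < dot l v) ->
  0 < T -> 0 <= G ->
  exists2 d, 0 < d & forall z, ~ escaping D f r T G d z.
Proof.
move=> Df fcont fB fcrit T0 G0; apply: contrapT => nod.
have /choice[z zesc] : forall j : nat, exists z, escaping D f r T G j.+1%:R^-1 z.
  move=> j; apply: contrapT => noz; apply: nod; exists j.+1%:R^-1 => // z zj.
  by apply: noz; exists z.
have [U [UU oU]] := ultraFilterLemma eventually_filter.
have [idx [Y YP]] := limit_curve_exists fB G0 zesc (UU := UU).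
have YL := limit_curve_lipschitz (UU := UU) oU G0 zesc YP.
have Yvel := limit_curve_velocity (UU := UU) oU G0 zesc YP.
have T01 : 0 <= (0 : R) <= T by rewrite lexx ltW.
have fY0 : f (Y 0) <= r.
  have [_ _ i0 c0] := YP 0 T01.
  have c0f : f (run_pos (z j) (idx 0 j)) @[j --> U] --> f (Y 0).
    by apply: continuous_cvg => //; exact: fcont.
  apply: (@closed_cvg _ _ U _ _ _ (@closed_le _ r) _ _ c0f).
  by apply: nearW => j; rewrite i0//; have [] := zesc j.
have fY t : 0 < t <= T -> r <= f (Y t).
  move=> /andP[t0 tT]; have tT' : 0 <= t <= T by rewrite ltW.
  have [iN iS _ ct] := YP t tT'.
  have ctf : f (run_pos (z j) (idx t j)) @[j --> U] --> f (Y t).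
    by apply: continuous_cvg => //; exact: fcont.
  apply: (@closed_cvg _ _ U _ _ _ (@closed_ge _ r) _ _ ctf).
  (* The bound from below starts at index 1. Index 0 has elapsed time 0, which is not within [t / 2]
     of [t], so [idx t j] is positive for [U]-almost all [j]. *)
  have t20 : 0 < t / 2 by rewrite divr_gt0.
  apply: filterS (ultra_natSinv_le oU t20) => j jt.
  have [_ fj _ _] := zesc j; apply: fj; rewrite iN andbT lt0n; apply/negP => /eqP i0.
  have := le_trans (iS j) jt; rewrite i0 elapsed0 sub0r normrN gtr0_norm//; lra.
have fYr : f (Y 0) = r.
  apply/eqP; rewrite eq_le fY0 leNgt; apply/negP => ltr.
  have : nbhs (Y 0) [set x | f x < r].
    exact: (fcont (Y 0) [set y | y < r] (lt_nbhsl ltr)).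
  move=> /nbhs_enormP[e e0 eY].
  pose t : R := Num.min T (e / (1 + G)).
  have G1 : 0 < 1 + G by rewrite ltr_wpDr.
  have t0 : 0 < t by rewrite lt_min T0 divr_gt0.
  have tT : t <= T by rewrite ge_min lexx.
  have te : (1 + G) * t <= e by rewrite mulrC -ler_pdivlMr// ge_min lexx orbT.
  have t01 : 0 <= t <= T by rewrite ltW.
  have : f (Y t) < r.
    apply: (eY (Y t)). apply: (le_trans (YL t 0 t01 T01)).
    by rewrite subr0 gtr0_norm//; move: te; rewrite mulrDl mul1r; lra.
  by rewrite ltNge fY// t0.
have [v vP] := fcrit _ fYr.
have [c [rho [c0 rho0 DY]]] :=
  graph_closed_usc (conservative_graph_closed Df) (conservative_locally_bounded Df) vP.
have G1 : 0 < 1 + G by rewrite ltr_wpDr.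
pose T1 : R := Num.min T (rho / (2 * (1 + G))).
have T10 : 0 < T1 by rewrite lt_min T0 divr_gt0// mulr_gt0.
have T1T : T1 <= T by rewrite ge_min lexx.
have T1rho : G * T1 <= rho / 2.
  have : (1 + G) * T1 <= rho / 2.
    by rewrite mulrC -ler_pdivlMr// ge_min -mulrA -invfM lexx orbT.
  by rewrite mulrDl mul1r; lra.
(* By Cauchy-Schwarz [dot u v <= - c] forces [kap <= dot u u]; the summand 1 keeps the denominator
   positive. *)
pose kap : R := c ^+ 2 / (1 + dot v v).
have v1 : 0 < 1 + dot v v by rewrite ltr_wpDr// dot_ge0.
have kap0 : 0 < kap by rewrite divr_gt0// exprn_gt0.
(* The velocity [u] serves as test direction. If every element of [D (Y s)] had a product above
   [- (kap / 2)] with it, semicontinuity would give a uniform bound [c'] above [- (kap / 2)] nearby,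
   hence [dot u u <= - c' < kap / 2]. *)
have descent s u : 0 < s < T1 -> has_velocity Y s u ->
    exists2 l, D (Y s) l & dot l u <= - (kap / 2).
  move=> /andP[s0 s1] vel.
  have sT : 0 < s < T by rewrite s0 (lt_le_trans s1).
  have rho2 : 0 < rho / 2 by rewrite divr_gt0.
  have uv : dot u v <= - c.
    apply: (Yvel _ _ _ _ _ sT rho2 vel) => x d xY; apply: DY.
    apply: (le_trans (ler_enorm_distD (Y s) _ _)).
    have s01 : 0 <= s <= T by move: sT; lra.
    have := YL _ _ s01 T01; rewrite subr0 (gtr0_norm s0).
    by have := ler_wpM2l G0 (ltW s1); lra.
  have ku : kap <= dot u u.
    rewrite /kap ler_pdivrMr//.
    have : c ^+ 2 <= dot u v ^+ 2 by rewrite -(sqrrN (dot _ _)) ler_sqr ?nnegrE; lra.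
    move=> /le_trans/(_ (cauchy_schwarz u v)) => h.
    by have := dot_ge0 u; lra.
  apply: contrapT => nol.
  have [l Dl|c' [rho' [cc' rho'0 DY']]] :=
    graph_closed_usc (conservative_graph_closed Df) (conservative_locally_bounded Df)
      (x := Y s) (u := u) (c := - (kap / 2)).
    by rewrite ltNge; apply/negP => lu; apply: nol; exists l.
  by have := Yvel _ _ _ _ _ sT rho'0 vel DY'; lra.
pose clamp (t : R) := Num.max 0 (Num.min t T1).
have clampT t : 0 <= clamp t <= T.
  by rewrite le_max lexx/= ge_max (ltW T0) ge_min T1T orbT.
have clampL s t : `|clamp s - clamp t| <= `|s - t|.
  exact: le_trans (ler_dist_maxr _ _ _) (ler_dist_minl _ _ _).
have clampE t : 0 <= t <= T1 -> clamp t = t.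
  by move=> /andP[t0 t1]; rewrite /clamp (min_idPl t1) (max_idPr t0).
(* [Y] is run backwards from [Y T1] to [Y 0], along which [f] gains at least [T1 * (kap / 2)].
   Clamping keeps the times inside [[0, T]], where [Y] is controlled. *)
pose gam s := Y (clamp (T1 * (1 - s))).
have gamL s t : enorm (gam s - gam t) <= G * T1 * `|s - t|.
  apply: (le_trans (YL _ _ (clampT _) (clampT _))); rewrite -mulrA ler_wpM2l//.
  apply: (le_trans (clampL _ _)).
  rewrite -mulrBr normrM (gtr0_norm T10) (distrC s).
  by rewrite (_ : 1 - s - (1 - t) = t - s)//; ring.
have k20 : 0 <= T1 * (kap / 2) by rewrite mulr_ge0// ltW// divr_gt0.
have := conservative_curve_increase Df k20 gamL.
have g0 : gam 0 = Y T1 by rewrite /gam subr0 mulr1 clampE// lexx ltW.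
have g1 : gam 1 = Y 0 by rewrite /gam subrr mulr0 clampE// lexx ltW.
rewrite g0 g1 fYr => H.
have : f (Y T1) + T1 * (kap / 2) <= r.
  apply: H => s l /andP[s0 s1] vel.
  have nT1 : - T1 != 0 by rewrite oppr_eq0 gt_eqF.
  have r0 : 0 < Num.min s (1 - s) by rewrite lt_min s0 subr_gt0.
  have gamE h : `|h| <= Num.min s (1 - s) -> gam (s + h) = Y (- T1 * (s + h) + T1) + 0.
    rewrite le_min !ler_norml => /andP[/andP[a1 a2] /andP[a3 a4]].
    rewrite addr0 /gam clampE; first by congr Y; ring.
    have q0 : 0 <= 1 - (s + h) by lra.
    have q1 : 1 - (s + h) <= 1 by lra.
    by rewrite (mulr_ge0 (ltW T10) q0)/= (ler_piMr (ltW T10) q1).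
  have := has_velocity_affine nT1 r0 gamE vel.
  move=> /descent[|d dD].
    have a1 : 0 < T1 * s by rewrite mulr_gt0.
    have a2 : 0 < T1 * (1 - s) by rewrite mulr_gt0// subr_gt0.
    lra.
  have -> : gam s = Y (- T1 * s + T1).
    by have := gamE 0; rewrite normr0 !addr0; apply; exact: ltW.
  rewrite dotZr invrN mulNr lerN2 ler_pdivlMl// => ?.
  by exists d.
have : r <= f (Y T1) by apply: fY; rewrite T10.
have : 0 < T1 * (kap / 2) by rewrite mulr_gt0// divr_gt0.
lra.
Qed.

End NoEscapeConclusion.

(** * Definable sets and functions *)

Section Definability.
Unset Implicit Arguments.
Context {R : realType} (Om : forall p : nat, set (set 'rV[R]_p)).
Set Implicit Arguments.
Hypothesis omin : o_minimal_structure Om.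

(* Formulas are predicates on valuations [e : nat -> R]; variables are de Bruijn
   levels, so that in [definable_in N P] the free variables of [P] are among
   [0, ..., N-1] and a quantifier binds variable [N]. *)
Definition env p (x : 'rV[R]_p) (i : nat) : R :=
  if insub i is Some j then x 0 j else 0.

Definition definable_in N (P : (nat -> R) -> Prop) :=
  Om N [set x : 'rV[R]_N | P (env x)].

Lemma env_ord p (x : 'rV[R]_p) (i : 'I_p) : env x i = x 0 i.
Proof. by rewrite /env valK. Qed.

Lemma env_lt p (x : 'rV[R]_p) i (ip : (i < p)%N) : env x i = x 0 (Ordinal ip).
Proof. by rewrite -env_ord. Qed.

Lemma env_ge p (x : 'rV[R]_p) i : (p <= i)%N -> env x i = 0.
Proof. by move=> pi; rewrite /env insubF// ltnNge pi. Qed.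

Lemma definable_ext N (P Q : (nat -> R) -> Prop) :
  (forall x : 'rV[R]_N, P (env x) <-> Q (env x)) ->
  definable_in N P -> definable_in N Q.
Proof.
move=> PQ; rewrite /definable_in; congr (Om _).
by apply/seteqP; split=> x /PQ.
Qed.

Lemma definable_and N P Q : definable_in N P -> definable_in N Q ->
  definable_in N (fun e => P e /\ Q e).
Proof. exact: omin_setI. Qed.

Lemma definable_or N P Q : definable_in N P -> definable_in N Q ->
  definable_in N (fun e => P e \/ Q e).
Proof. exact: omin_setU. Qed.

Lemma definable_not N P : definable_in N P -> definable_in N (fun e => ~ P e).
Proof. exact: omin_setC. Qed.

Lemma definable_true N : definable_in N (fun=> True).
Proof.
apply: (@definable_ext N (fun=> ~ False)) => [x|]; first by tauto.
apply: definable_not; rewrite /definable_in.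
by rewrite (_ : [set x | False] = set0)//; exact: omin_set0.
Qed.

Lemma definable_imp N P Q : definable_in N P -> definable_in N Q ->
  definable_in N (fun e => P e -> Q e).
Proof.
move=> dP dQ; apply: (@definable_ext N (fun e => ~ P e \/ Q e)) => [x|].
  by have [] := pselect (P (env x)); tauto.
by apply: definable_or => //; exact: definable_not.
Qed.

Lemma definable_all_ord N q (P : 'I_q -> (nat -> R) -> Prop) :
  (forall i, definable_in N (P i)) -> definable_in N (fun e => forall i, P i e).
Proof.
move=> dP; apply: (@definable_ext N (fun e => forall i, i \in enum 'I_q -> P i e)).
  by move=> x; split=> H i => [|_]; apply: H; rewrite mem_enum.
elim: (enum 'I_q) => [|j s IH].
  by apply: definable_ext (definable_true N) => x; split.
apply: definable_ext (definable_and (dP j) IH) => x; split=> [[Pj Ps] i|H].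
  by rewrite inE => /predU1P[->|/Ps].
by split=> [|i si]; apply: H; rewrite inE ?eqxx// si orbT.
Qed.

Definition upd (e : nat -> R) N a i := if i == N then a else e i.

(** Binds the block of variables [N, ..., N + q - 1] at once, for quantifiers over vectors; [vec]
    reads a block back. *)
Definition updv q (e : nat -> R) N (z : 'rV[R]_q) i :=
  if (i < N)%N then e i else if (i - N < q)%N then env z (i - N) else e i.

Definition vec q (e : nat -> R) o : 'rV[R]_q := \row_(i < q) e (o + i)%N.

(** Projection along the last coordinate is quantification over variable [N]. *)
Lemma definable_ex N P : definable_in N.+1 P ->
  definable_in N (fun e => exists a, P (upd e N a)).
Proof.
move=> /(omin_proj omin ord_max); rewrite /definable_in; congr (Om _).
have envE (x : 'rV[R]_N.+1) : env x = upd (env (col' ord_max x)) N (x 0 ord_max).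
  apply/funext => i; rewrite /upd; have [->|iN] := eqVneq i N.
    by rewrite env_lt; congr (x 0 _); exact/val_inj.
  have [iltN|Ni] := ltnP i N; last first.
    by rewrite !env_ge// ltn_neqAle eq_sym iN Ni.
  rewrite (env_lt _ (ltnW iltN : (i < N.+1)%N)) (env_lt _ iltN) mxE; congr (x 0 _).
  by apply/val_inj; rewrite /= /bump leqNgt iltN.
apply/seteqP; split=> [_ [x Px <-]|x [a Pa]] /=.
  by exists (x 0 ord_max); rewrite -envE.
exists (\row_i upd (env x) N a i).
  rewrite /= (_ : env _ = upd (env x) N a)//; apply/funext => i.
  have [iN|Ni] := ltnP i N.+1; first by rewrite env_lt mxE.
  by rewrite env_ge// /upd gtn_eqF// env_ge// ltnW.
apply/rowP => i; rewrite !mxE /upd /= /bump leqNgt ltn_ord add0n.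
by rewrite ltn_eqF// env_ord.
Qed.

Lemma definable_exv N q P : definable_in (N + q) P ->
  definable_in N (fun e => exists z : 'rV[R]_q, P (updv e N z)).
Proof.
elim: q P => [|q IH] P.
  rewrite addn0; apply: definable_ext => x; split=> [Px|[z]]; last first.
    by congr P; apply/funext => i; rewrite /updv ltn0 if_same.
  by exists 0; rewrite (_ : updv _ _ _ = env x)//; apply/funext => i; rewrite /updv ltn0 if_same.
rewrite addnS => /definable_ex/IH; apply: definable_ext => x; split=> [[z [a]]|[z]].
  move=> H; exists (\row_i upd (env z) q a i); congr P: H; apply/funext => i.
  rewrite /upd /updv; have [iN|Ni] := ltnP i N.
    by rewrite ltn_eqF// (leq_trans iN)// leq_addr.
  rewrite ltnS; have [->|iNq] := eqVneq i (N + q)%N.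
    by rewrite addKn ?ltnn ?leqnn ?ltnSn env_lt mxE /= eqxx.
  rewrite [(i - N <= q)%N]leq_eqVlt; have -> : (i - N == q)%N = false.
    by apply/negP => /eqP E; move: iNq; rewrite -E subnKC// eqxx.
  rewrite /=; case: ltnP => // iNq'.
  by rewrite (env_lt _ (ltnW iNq' : (i - N < q.+1)%N)) mxE /= ltn_eqF// env_lt.
move=> H; exists (\row_i env z i), (env z q); congr P: H; apply/funext => i.
rewrite /upd /updv; have [iN|Ni] := ltnP i N.
  by rewrite ltn_eqF// (leq_trans iN)// leq_addr.
rewrite ltnS; have [->|iNq] := eqVneq i (N + q)%N; first by rewrite addKn ?ltnn ?leqnn ?ltnSn.
rewrite [(i - N <= q)%N]leq_eqVlt; have -> : (i - N == q)%N = false.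
  by apply/negP => /eqP E; move: iNq; rewrite -E subnKC// eqxx.
by rewrite /=; case: ltnP => // iNq'; rewrite [RHS]env_lt mxE.
Qed.

Lemma definable_allv N q P : definable_in (N + q) P ->
  definable_in N (fun e => forall z : 'rV[R]_q, P (updv e N z)).
Proof.
move=> /definable_not/definable_exv/definable_not; apply: definable_ext => x.
split=> [H z|H [z]]; last exact.
by apply: contrapT => nP; apply: H; exists z.
Qed.

Lemma updv_lt q (e : nat -> R) N (z : 'rV[R]_q) i : (i < N)%N -> updv e N z i = e i.
Proof. by rewrite /updv => ->. Qed.

Lemma updv_add q (e : nat -> R) N (z : 'rV[R]_q) (i : 'I_q) : updv e N z (N + i)%N = z 0 i.
Proof. by rewrite /updv ltnNge leq_addr/= addKn ltn_ord env_ord. Qed.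

Lemma vec_updv q (e : nat -> R) N (z : 'rV[R]_q) : vec q (updv e N z) N = z.
Proof. by apply/rowP => i; rewrite mxE updv_add. Qed.

Lemma vec_updv_lt q' q (e : nat -> R) N (z : 'rV[R]_q) o : (o + q' <= N)%N ->
  vec q' (updv e N z) o = vec q' e o.
Proof.
move=> oN; apply/rowP => i; rewrite !mxE updv_lt//.
by rewrite (leq_trans _ oN)// ltn_add2l.
Qed.

Definition polynomial_in N (F : (nat -> R) -> R) :=
  exists P : mpoly.mpoly N R, forall x : 'rV[R]_N,
    F (env x) = mpoly.meval (fun i => x 0 i) P.

Lemma polynomial_var N i : (i < N)%N -> polynomial_in N (fun e => e i).
Proof.
move=> iN; exists (mpoly.mpolyX R (mpoly.mnm1 (Ordinal iN))) => x.
by rewrite mpoly.mevalXU env_lt.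
Qed.

Lemma polynomial_add N F1 F2 : polynomial_in N F1 -> polynomial_in N F2 ->
  polynomial_in N (fun e => F1 e + F2 e).
Proof. by move=> [P HP] [Q HQ]; exists (P + Q) => x; rewrite mpoly.mevalD HP HQ. Qed.

Lemma polynomial_sub N F1 F2 : polynomial_in N F1 -> polynomial_in N F2 ->
  polynomial_in N (fun e => F1 e - F2 e).
Proof. by move=> [P HP] [Q HQ]; exists (P - Q) => x; rewrite mpoly.mevalB HP HQ. Qed.

Lemma polynomial_mul N F1 F2 : polynomial_in N F1 -> polynomial_in N F2 ->
  polynomial_in N (fun e => F1 e * F2 e).
Proof. by move=> [P HP] [Q HQ]; exists (P * Q) => x; rewrite mpoly.mevalM HP HQ. Qed.

Lemma polynomial_cst N c : polynomial_in N (fun=> c).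
Proof. by exists (mpoly.mpolyC N c) => x; rewrite mpoly.mevalC. Qed.

Lemma polynomial_sum N q (F : 'I_q -> (nat -> R) -> R) :
  (forall i, polynomial_in N (F i)) -> polynomial_in N (fun e => \sum_i F i e).
Proof.
move=> pF; suff H s : polynomial_in N (fun e => \sum_(i <- s) F i e) by exact: H.
elim: s => [|i s IH].
  by have [P HP] := polynomial_cst N 0; exists P => x; rewrite big_nil -HP.
have [P HP] := polynomial_add (pF i) IH.
by exists P => x; rewrite big_cons -HP.
Qed.

Lemma polynomial_vec N q o (i : 'I_q) : (o + q <= N)%N ->
  polynomial_in N (fun e => vec q e o 0 i).
Proof.
move=> oN; have oiN : (o + i < N)%N by rewrite (leq_trans _ oN)// ltn_add2l.
by have [P HP] := polynomial_var oiN; exists P => x; rewrite mxE HP.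
Qed.

Lemma definable_poly0 N F : polynomial_in N F -> definable_in N (fun e => F e = 0).
Proof.
move=> [P HP]; have := omin_poly omin P; rewrite /definable_in; congr (Om _).
by apply/seteqP; split=> x /=; rewrite HP.
Qed.

Lemma definable_eq N F1 F2 : polynomial_in N F1 -> polynomial_in N F2 ->
  definable_in N (fun e => F1 e = F2 e).
Proof.
move=> p1 p2; apply: definable_ext (definable_poly0 (polynomial_sub p1 p2)) => x.
by split=> [/eqP|->]; rewrite ?subrr// subr_eq0 => /eqP.
Qed.

Lemma definable_vec N q (A : set 'rV[R]_q) : Om q A ->
  definable_in (N + q) (fun e => A (vec q e N)).
Proof.
move=> OA; elim: N => [|N IH].
  rewrite /definable_in (_ : [set x | _] = A)//; apply/seteqP.
  have E (x : 'rV[R]_q) : vec q (env x) 0 = x by apply/rowP => i; rewrite mxE env_ord.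
  by split=> x /=; rewrite E.
have := omin_prodl omin IH; rewrite /definable_in addSn; congr (Om _).
have E (x : 'rV[R]_(N + q).+1) : vec q (env (col' ord0 x)) N = vec q (env x) N.+1.
  apply/rowP => i; rewrite !mxE addSn.
  have Niq : (N + i < N + q)%N by rewrite ltn_add2l.
  rewrite (env_lt _ Niq) (env_lt _ (Niq : (N + i).+1 < (N + q).+1)%N) mxE.
  by congr (x 0 _); exact: val_inj.
by apply/seteqP; split=> x /=; rewrite E.
Qed.

(** A fresh block is quantified, required to lie in [A] and equated coordinatewise with the chosen
    variables; the renaming [s] may thus repeat or permute variables. *)
Lemma definable_subst N q (A : set 'rV[R]_q) (s : 'I_q -> nat) : Om q A ->
  (forall i, (s i < N)%N) -> definable_in N (fun e => A (\row_i e (s i))).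
Proof.
move=> OA sN.
have eqs (i : 'I_q) : definable_in (N + q) (fun e => e (N + i)%N = e (s i)).
  by apply: definable_eq; apply: polynomial_var; rewrite ?ltn_add2l// ltn_addr.
apply: definable_ext (definable_exv (definable_and (definable_vec N OA) (definable_all_ord eqs))).
move=> x; split=> [[z []]|Ax].
  rewrite vec_updv => Az zs; rewrite (_ : \row_i _ = z)//.
  by apply/rowP => i; rewrite mxE -(updv_add (env x) N) zs updv_lt.
exists (\row_i env x (s i)); split; first by rewrite vec_updv.
by move=> i; rewrite updv_add mxE updv_lt.
Qed.

Lemma definable_itv N (I : interval R) i : (i < N)%N ->
  definable_in N (fun e => e i \in I).
Proof.
move=> iN; have OI : Om 1 [set x : 'rV[R]_1 | x 0 0 \in I].
  apply/(omin_dim1 omin); exists [:: I]; apply/seteqP; split=> x /=.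
    by move=> xI; exists I; rewrite ?inE.
  by move=> [J]; rewrite inE => /eqP->.
apply: definable_ext (definable_subst (s := fun=> i) OI (fun=> iN)) => x.
by rewrite /= mxE.
Qed.

(** The order comes from the intervals of the line: the fresh variable [N] names the value of [F]
    and is confined to []-oo, 0]]. *)
Lemma definable_le0 N F : polynomial_in N.+1 F ->
  (forall (x : 'rV[R]_N) a, F (upd (env x) N a) = F (env x)) ->
  definable_in N (fun e => F e <= 0).
Proof.
move=> pF Fupd.
apply: definable_ext (definable_ex (definable_and
  (definable_eq pF (polynomial_var (ltnSn N))) (definable_itv `]-oo, 0] (ltnSn N)))).
move=> x; rewrite /upd eqxx; split=> [[a]|Fx].
  by rewrite Fupd in_itv/= => -[->].
by exists (F (env x)); rewrite in_itv/= Fupd.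
Qed.

Lemma upd_lt (e : nat -> R) N a i : (i < N)%N -> upd e N a i = e i.
Proof. by move=> iN; rewrite /upd ltn_eqF. Qed.

Lemma upd_eq (e : nat -> R) N a : upd e N a N = a.
Proof. by rewrite /upd eqxx. Qed.

Lemma vec_upd q (e : nat -> R) N a o : (o + q <= N)%N -> vec q (upd e N a) o = vec q e o.
Proof.
move=> oN; apply/rowP => i; rewrite !mxE upd_lt//.
by rewrite (leq_trans _ oN)// ltn_add2l.
Qed.

Lemma definable_le N i j : (i < N)%N -> (j < N)%N -> definable_in N (fun e => e i <= e j).
Proof.
move=> iN jN; apply: (@definable_ext N (fun e => e i - e j <= 0)).
  by move=> x; rewrite subr_le0.
apply: definable_le0 => [|x a]; last by rewrite !upd_lt.
by apply: polynomial_sub; apply: polynomial_var; exact: ltnW.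
Qed.

Lemma definable_lt N i j : (i < N)%N -> (j < N)%N -> definable_in N (fun e => e i < e j).
Proof.
move=> iN jN; apply: definable_ext (definable_not (definable_le jN iN)) => x.
by rewrite ltNge; split=> /negP.
Qed.

Lemma definable_dot_le0 N q o o' : (o + q <= N)%N -> (o' + q <= N)%N ->
  definable_in N (fun e => dot (vec q e o) (vec q e o') <= 0).
Proof.
move=> oN o'N; apply: definable_le0 => [|x a]; last by rewrite !vec_upd.
by apply: polynomial_sum => i; apply: polynomial_mul; apply: polynomial_vec; exact: leqW.
Qed.

Lemma definable_rel N p q (S : 'rV[R]_p -> set 'rV[R]_q) o o' :
  definable_map Om S -> (o + p <= N)%N -> (o' + q <= N)%N ->
  definable_in N (fun e => S (vec p e o) (vec q e o')).
Proof.
move=> dS oN o'N.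
pose s (i : 'I_(p + q)) := match fintype.split i with inl j => (o + j)%N | inr j => (o' + j)%N end.
have sN i : (s i < N)%N.
  rewrite /s; case: fintype.split => j.
    by rewrite (leq_trans _ oN)// ltn_add2l.
  by rewrite (leq_trans _ o'N)// ltn_add2l.
apply: definable_ext (definable_subst dS sN) => x.
have -> : \row_i env x (s i) = row_mx (vec p (env x) o) (vec q (env x) o').
  by apply/rowP => i; rewrite !mxE /s; case: fintype.split => j; rewrite mxE.
split=> [[y [d [Syd]]]|Sx]; last by exists (vec p (env x) o), (vec q (env x) o').
by move=> /eq_row_mx[-> ->].
Qed.

End Definability.

(** * Definable subsets of the line and one-sided germs *)

Section OneVariable.
Unset Implicit Arguments.
Context {R : realType} (Om : forall p : nat, set (set 'rV[R]_p)).
Set Implicit Arguments.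
Hypothesis omin : o_minimal_structure Om.

(** Choosing labels would inject the interval into a countable type, whereas its Lebesgue measure is
    positive. *)
Lemma itv_uncountable (C : countType) (a b : R) (P : R -> C -> Prop) : a < b ->
  (forall x, a < x < b -> exists c, P x c) ->
  (forall x y c, a < x < b -> a < y < b -> x < y -> P x c -> P y c -> False) -> False.
Proof.
move=> ab Pex Pinj.
have /choice[F FP] : forall x : R, exists c : option C,
    a < x < b -> exists2 c', c = Some c' & P x c'.
  move=> x; have [xab|] := boolP (a < x < b); last by exists None.
  by have [c Pc] := Pex x xab; exists (Some c) => _; exists c.
have cI : countable (`]a, b[%classic : set R).
  apply/countable_injP; exists (choice.pickle \o F) => x y.
  rewrite !inE/= !in_itv/= => xab yab /(pcan_inj choice.pickleK) Fxy.
  have [c Ec Pc] := FP x xab; have [c' Ec' Pc'] := FP y yab.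
  have cc' : c = c' by move: Fxy; rewrite Ec Ec' => -[].
  rewrite -{}cc' in Pc'; apply/eqP; rewrite eq_le !leNgt.
  apply/andP; split; apply/negP => h.
    exact: (Pinj y x c yab xab h Pc' Pc).
  exact: (Pinj x y c xab yab h Pc Pc').
have := countable_lebesgue_measure0 cI; rewrite lebesgue_measure_itv/= lte_fin ab.
by move=> [] /eqP; rewrite subr_eq0 gt_eqF.
Qed.

(** O-minimality in local form: next to [x], on the right for [s = 1] and on the left for [s = -1],
    the truth value of [Q] is constant. *)
Definition side_decided (s x : R) (Q : R -> Prop) := exists2 e, 0 < e &
  (forall h, 0 < h < e -> Q (x + s * h)) \/ (forall h, 0 < h < e -> ~ Q (x + s * h)).

Lemma side_decided_iff s x (P Q : R -> Prop) : (forall t, P t <-> Q t) ->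
  side_decided s x P -> side_decided s x Q.
Proof.
by move=> PQ [e e0 [H|H]]; exists e => //; [left|right] => h /H; rewrite PQ.
Qed.

Lemma side_decided_not s x Q : side_decided s x Q -> side_decided s x (fun t => ~ Q t).
Proof.
move=> [e e0 H]; exists e => //.
by case: H => H; [right => h /H Qh nQ; exact: nQ|left => h /H].
Qed.

Lemma side_decided_and s x P Q : side_decided s x P -> side_decided s x Q ->
  side_decided s x (fun t => P t /\ Q t).
Proof.
move=> [e e0 HP] [d d0 HQ]; exists (Num.min e d); first by rewrite lt_min e0.
have le h : 0 < h < Num.min e d -> 0 < h < e /\ 0 < h < d.
  by rewrite lt_min => /and3P[-> -> ->].
case: HP => HP; last by right => h /le[/HP P' _] [].
case: HQ => HQ; last by right => h /le[_ /HQ Q'] [].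
by left => h /le[/HP P' /HQ Q'].
Qed.

Lemma side_decided_or s x P Q : side_decided s x P -> side_decided s x Q ->
  side_decided s x (fun t => P t \/ Q t).
Proof.
move=> /side_decided_not HP /side_decided_not HQ.
have := side_decided_not (side_decided_and HP HQ).
by apply: side_decided_iff => t; have [] := pselect (P t); have [] := pselect (Q t); tauto.
Qed.

Lemma side_decided_lt s x c : (s = 1 \/ s = -1) -> side_decided s x (fun t => c < t).
Proof.
move=> [->|->].
  have [cx|xc] := leP c x.
    by exists 1 => //; left => h; lra.
  by exists (c - x); [lra|right => h hc; apply/negP; lra].
have [xc|cx] := leP x c.
  by exists 1 => //; right => h hc; apply/negP; lra.
by exists (x - c); [lra|left => h; lra].
Qed.

Lemma side_decided_gt s x c : (s = 1 \/ s = -1) -> side_decided s x (fun t => t < c).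
Proof.
move=> hs.
have hs' : - s = 1 \/ - s = -1 by case: hs => ->; rewrite ?opprK; [right|left].
have [e e0 H] := side_decided_lt (- x) (- c) hs'; exists e => //.
by case: H => H; [left|right] => h /H; rewrite mulNr -opprD ltrN2.
Qed.

Lemma side_decided_itv s x (I : interval R) : (s = 1 \/ s = -1) ->
  side_decided s x (fun t => t \in I).
Proof.
move=> hs.
have cst b : side_decided s x (fun=> is_true b).
  by exists 1 => //; case: b; [left|right].
have lb (l : itv_bound R) : side_decided s x (fun t => (l <= BLeft t)%O).
  case: l => [[] c|[]] /=; last 2 first.
  - by apply: side_decided_iff (cst true).
  - by apply: side_decided_iff (cst false).
  - apply: side_decided_iff (side_decided_not (side_decided_gt x c hs)) => t.
    by rewrite bnd_simp leNgt; split=> /negP.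
  - by apply: side_decided_iff (side_decided_lt x c hs) => t; rewrite bnd_simp.
have rb (l : itv_bound R) : side_decided s x (fun t => (BRight t <= l)%O).
  case: l => [[] c|[]] /=; last 2 first.
  - by apply: side_decided_iff (cst false).
  - by apply: side_decided_iff (cst true).
  - by apply: side_decided_iff (side_decided_gt x c hs) => t; rewrite bnd_simp.
  - apply: side_decided_iff (side_decided_not (side_decided_lt x c hs)) => t.
    by rewrite bnd_simp leNgt; split=> /negP.
case: I => l u; apply: side_decided_iff (side_decided_and (lb l) (rb u)) => t.
by rewrite itv_boundlr; split=> [[-> ->]//|/andP].
Qed.

Lemma definable_side_decided (P : R -> Prop) s x : (s = 1 \/ s = -1) ->
  definable_in Om 1 (fun e => P (e 0%N)) -> side_decided s x P.
Proof.
move=> hs /(omin_dim1 omin)[l lE].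
have : side_decided s x (fun t => exists2 I, I \in l & t \in I).
  elim: l {lE} => [|I l IH]; first by exists 1 => //; right => h _ [].
  apply: side_decided_iff (side_decided_or (side_decided_itv x I hs) IH) => t.
  split=> [[tI|[J Jl tJ]]|[J]]; first by exists I; rewrite // inE eqxx.
    by exists J; rewrite // inE Jl orbT.
  by rewrite inE => /predU1P[->|Jl tJ]; [left|right; exists J].
apply: side_decided_iff => t.
have /= := congr1 (fun A : set 'rV[R]_1 => A (const_mx t)) lE.
by rewrite mxE (env_lt _ (ltn0Sn 0)) mxE => ->.
Qed.

Lemma definable_subitv (P : R -> Prop) a b : a < b ->
  definable_in Om 1 (fun e => P (e 0%N)) ->
  exists a' b', [/\ a <= a', a' < b', b' <= b &
    (forall x, a' < x < b' -> P x) \/ (forall x, a' < x < b' -> ~ P x)].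
Proof.
move=> ab dP; have [e e0 H] := @definable_side_decided P 1 a (or_introl erefl) dP.
exists a, (Num.min b (a + e)); split => //; first by rewrite lt_min ab ltrDl.
  by rewrite ge_min lexx.
by case: H => H; [left|right] => x; rewrite lt_min => xab;
  have := H (x - a); rewrite mul1r addrCA subrr addr0; apply; lra.
Qed.

(** Argument and value may sit at any two variables, so that the graph can be used directly inside
    formulas. *)
Definition definable_fun1 (h : R -> R) := forall N i j, (i < N)%N -> (j < N)%N ->
  definable_in Om N (fun e => e j = h (e i)).

Lemma definable_fun1N h : definable_fun1 h -> definable_fun1 (fun t => - h t).
Proof.
move=> dh N i j iN jN.
apply: (@definable_ext _ Om N (fun e => exists u, upd e N u N = h (upd e N u i) /\
   upd e N u j = 0 - upd e N u N)).
  move=> x; split=> [[u]|E]; last exists (h (env x i)); rewrite !upd_eq !upd_lt//.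
    by move=> [-> ->]; rewrite sub0r.
  by rewrite sub0r.
apply: (definable_ex omin (P := fun e => e N = h (e i) /\ e j = 0 - e N)).
apply: definable_and => //; first by apply: dh => //; exact: ltnW.
apply: definable_eq => //; first by apply: polynomial_var; exact: ltnW.
by apply: polynomial_sub; [exact: polynomial_cst|exact: polynomial_var].
Qed.

Lemma definable_fun1_lt h N i j : definable_fun1 h -> (i < N)%N -> (j < N)%N ->
  definable_in Om N (fun e => h (e i) < h (e j)).
Proof.
move=> dh iN jN.
apply: (@definable_ext _ Om N (fun e => exists u, exists v,
   upd (upd e N u) N.+1 v N = h (upd (upd e N u) N.+1 v i) /\
   (upd (upd e N u) N.+1 v N.+1 = h (upd (upd e N u) N.+1 v j) /\
    upd (upd e N u) N.+1 v N < upd (upd e N u) N.+1 v N.+1))).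
  move=> x.
  have E u v : [/\ upd (upd (env x) N u) N.+1 v N = u,
    upd (upd (env x) N u) N.+1 v N.+1 = v,
    upd (upd (env x) N u) N.+1 v i = env x i & upd (upd (env x) N u) N.+1 v j = env x j].
    by rewrite !upd_eq upd_lt ?ltnSn// upd_eq !upd_lt// ltnW.
  split=> [[u [v]]|H].
    by have [-> -> -> ->] := E u v => -[-> [->]].
  exists (h (env x i)), (h (env x j)).
  by have [-> -> -> ->] := E (h (env x i)) (h (env x j)).
apply: (definable_ex omin (P := fun e => exists v, upd e N.+1 v N = h (upd e N.+1 v i) /\
   (upd e N.+1 v N.+1 = h (upd e N.+1 v j) /\ upd e N.+1 v N < upd e N.+1 v N.+1))).
apply: (definable_ex omin (P := fun e => e N = h (e i) /\ (e N.+1 = h (e j) /\ e N < e N.+1))).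
apply: definable_and => //; first by apply: dh; rewrite ?ltnS// leqW// ltnW.
apply: definable_and => //; first by apply: dh; rewrite ?ltnS// leqW// ltnW.
by apply: definable_lt => //; rewrite ltnS leqW.
Qed.

(* [s = 1] looks to the right of [t], [s = -1] to its left. *)
Definition local_above (s : R) (h : R -> R) (t : R) := exists2 e, 0 < e &
  forall d, 0 < d < e -> h t < h (t + s * d).

Lemma definable_local_above s h : definable_fun1 h ->
  definable_in Om 1 (fun e => local_above s h (e 0%N)).
Proof.
move=> dh.
apply: (@definable_ext _ Om 1 (fun e => exists c, 0 < c /\
   (forall d, 0 < d /\ d < c -> h (e 0%N) < h (e 0%N + s * d)))).
  move=> x; split=> [[c [c0 H]]|[c c0 H]].
    exists c => // d /andP; exact: H.
  by exists c; split=> // d /andP/H.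
(* Variable 0 is the point, 1 the radius, 2 the increment and 3 the displaced point. *)
pose Q (e : nat -> R) := e 3%N = e 0%N + s * e 2%N /\ h (e 0%N) < h (e 3%N).
pose P (e : nat -> R) := forall z : 'rV[R]_1, let e' := updv e 2 z in
  (0 < e' 2%N /\ e' 2%N < e' 1%N) -> exists b, Q (upd e' 3 b).
apply: (@definable_ext _ Om 1 (fun e => exists c, 0 < upd e 1 c 1%N /\ P (upd e 1 c))).
  move=> x; split=> -[c [c0 H]]; exists c; split; rewrite ?upd_eq// in c0 *.
    move=> d d0; have := H (const_mx d); rewrite /= (updv_add _ 2 _ (ord0 : 'I_1)).
    rewrite mxE updv_lt// upd_eq => /(_ d0)[b].
    rewrite /Q upd_eq !upd_lt// (updv_add _ 2 _ (ord0 : 'I_1)) mxE !updv_lt// upd_lt//.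
    by move=> [->].
  move=> z; rewrite /= (updv_add _ 2 z (ord0 : 'I_1)) updv_lt// upd_eq => /H zH.
  exists (env x 0%N + s * z 0 0).
  by rewrite /Q upd_eq !upd_lt// (updv_add _ 2 _ (ord0 : 'I_1)) !updv_lt// upd_lt.
apply: (definable_ex omin (P := fun e => 0 < e 1%N /\ P e)).
have pos N i : (i < N)%N -> definable_in Om N (fun e => 0 < e i).
  move=> iN; apply: definable_ext (definable_itv omin `]0, +oo[ iN) => x.
  by rewrite in_itv/= andbT.
apply: definable_and => //; first exact: pos.
apply: (definable_allv omin (P := fun e' => (0 < e' 2%N /\ e' 2%N < e' 1%N) ->
   exists b, Q (upd e' 3 b))).
apply: definable_imp => //.
  by apply: definable_and => //; [exact: pos|exact: definable_lt].
apply: definable_ex => //; apply: definable_and => //; last exact: definable_fun1_lt.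
apply: definable_eq => //; first exact: polynomial_var.
apply: polynomial_add; first exact: polynomial_var.
by apply: polynomial_mul; [exact: polynomial_cst|exact: polynomial_var].
Qed.

End OneVariable.

(** * The monotonicity theorem for definable functions *)

Section Monotonicity.
Unset Implicit Arguments.
Context {R : realType} (Om : forall p : nat, set (set 'rV[R]_p)).
Set Implicit Arguments.
Hypothesis omin : o_minimal_structure Om.

(* Isolating each strict local minimum by rational endpoints shows that there are only countably
   many. *)
Lemma strict_local_min_itv_false (h : R -> R) a b : a < b ->
  (forall t, a < t < b -> local_above 1 h t /\ local_above (-1) h t) -> False.
Proof.
move=> ab H.
pose P (x : R) (c : rat * rat) := ratr c.1 < x < ratr c.2 /\
  forall y, ratr c.1 < y < ratr c.2 -> y != x -> h x < h y.
apply: (@itv_uncountable R _ a b P ab) => [x xab|x y c xab yab xy [cx Px] [cy Py]].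
  have [[e e0 He] [d d0 Hd]] := H x xab.
  have [p] := @rat_in_itvoo R (x - d) x ltac:(by rewrite ltrBlDr ltrDl).
  have [q] := @rat_in_itvoo R x (x + e) ltac:(by rewrite ltrDl).
  rewrite !in_itv/= => /andP[q1 q2] /andP[p1 p2].
  exists (p, q); split; first by rewrite /= p2 q1.
  move=> y /= /andP[py yq] yx; have [ylt|ygt|E] := ltgtP y x; last by rewrite E eqxx in yx.
    have := Hd (x - y); rewrite mulN1r opprB addrCA subrr addr0; apply; lra.
  have := He (y - x); rewrite mul1r addrCA subrr addr0; apply; lra.
have := Px y cy; rewrite gt_eqF// => /(_ isT).
have := Py x cx; rewrite lt_eqF// => /(_ isT).
by move=> h1 h2; have := lt_trans h1 h2; rewrite ltxx.
Qed.

(** Consider the supremum of the points up to which [h] stays above [h x]: the left-hand hypothesis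
    carries the inequality to the supremum, the right-hand one carries it past any point before
    [y]. *)
Lemma locally_increasing (h : R -> R) a b :
  (forall t, a < t < b -> local_above 1 h t) ->
  (forall t, a < t < b -> local_above (-1) (fun t => - h t) t) ->
  forall x y, a < x -> x < y -> y < b -> h x < h y.
Proof.
move=> Hr Hl x y ax xy yb.
pose S := [set z | x <= z <= y /\ forall w, x < w <= z -> h x < h w].
have Sx : S x by split=> [|w /andP[xw wx]]; [rewrite lexx ltW|have := lt_le_trans xw wx; rewrite ltxx].
have Sub z : S z -> z <= y by move=> [/andP[]].
have hS : has_sup S by split; [exists x|exists y => z /Sub].
set s := sup S.
have xs : x <= s by apply: ub_le_sup => //; case: hS.
have sy : s <= y by apply: ge_sup => //; exists x.
have below w : x < w < s -> h x < h w.
  move=> /andP[xw ws]; have sw0 : 0 < s - w by rewrite subr_gt0.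
  have [z [_ Hz]] := sup_adherent sw0 hS; rewrite -/s opprB addrCA subrr addr0 => wz.
  by apply: Hz; rewrite xw ltW.
have extend z : x <= z -> z < y -> (forall w, x < w <= z -> h x < h w) ->
    (z = x \/ h x < h z) -> z < s.
  move=> xz zy Hz hz.
  have [|e e0 He] := Hr z; first lra.
  pose d := Num.min (e / 2) (y - z).
  have d0 : 0 < d by rewrite lt_min divr_gt0// subr_gt0.
  have de : d <= e / 2 by rewrite ge_min lexx.
  have dy : d <= y - z by rewrite ge_min lexx orbT.
  have : S (z + d).
    split=> [|w /andP[xw wz]]; first by apply/andP; split; lra.
    have [wz'|zw] := leP w z; first by apply: Hz; rewrite xw.
    have hzw : h z < h w by have := He (w - z); rewrite mul1r addrCA subrr addr0; apply; lra.
    by case: hz => [<-//|hxz]; exact: lt_trans hzw.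
  move=> /(ub_le_sup (proj2 hS)); rewrite -/s; lra.
have xs' : x < s.
  by apply: extend => // [w /andP[xw wx]|]; [have := lt_le_trans xw wx; rewrite ltxx|left].
have hxs : h x < h s.
  have [|e e0 He] := Hl s; first lra.
  pose m := (Num.max x (s - e) + s) / 2.
  have m1 : x < m.
    by rewrite /m; have : x <= Num.max x (s - e) by [rewrite le_max lexx]; lra.
  have m2 : s - e < m.
    by rewrite /m; have : s - e <= Num.max x (s - e) by [rewrite le_max lexx orbT]; lra.
  have m3 : m < s.
    by rewrite /m; have : Num.max x (s - e) < s by [rewrite gt_max xs'/=; lra]; lra.
  apply: (@lt_trans _ _ (h m)); first by apply: below; rewrite m1.
  have := He (s - m); rewrite mulN1r opprB addrCA subrr addr0 ltrN2; apply; lra.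
have [sy'|ys] := ltP s y; last by have -> : y = s by apply/eqP; rewrite eq_le ys sy.
have := extend s xs sy' _ (or_intror hxs); rewrite ltxx => H'; exfalso.
suff : false by [].
apply: H' => w /andP[xw]; rewrite le_eqVlt => /predU1P[->//|ws].
by apply: below; rewrite xw.
Qed.

Definition monotone_on (a b : R) (h : R -> R) :=
  (forall x y, a <= x -> x <= y -> y <= b -> h x <= h y) \/
  (forall x y, a <= x -> x <= y -> y <= b -> h y <= h x).

(* The image is a definable set. If it left a gap just above each of its points, these gaps would
   be uncountably many disjoint intervals. *)
Lemma strictly_increasing_subitv_continuous (h : R -> R) a b : definable_fun1 Om h ->
  a < b -> (forall x y, a < x -> x < y -> y < b -> h x < h y) ->
  exists a' b', [/\ a < a', a' < b', b' < b & {within `[a', b'], continuous h}].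
Proof.
move=> dh ab mono.
pose E c := exists t, (a < t /\ t < b) /\ c = h t.
have dE : definable_in Om 1 (fun e => E (e 0%N)).
  have lt1 N i c : (i < N)%N -> definable_in Om N (fun e => c < e i).
    by move=> iN; apply: definable_ext (definable_itv omin `]c, +oo[ iN) => x; rewrite in_itv/= andbT.
  have gt1 N i c : (i < N)%N -> definable_in Om N (fun e => e i < c).
    by move=> iN; apply: definable_ext (definable_itv omin `]-oo, c[ iN) => x; rewrite in_itv/=.
  apply: (@definable_ext _ Om 1 (fun e => exists t,
    (a < upd e 1 t 1%N /\ upd e 1 t 1%N < b) /\ upd e 1 t 0%N = h (upd e 1 t 1%N))).
    by move=> x; split=> -[t]; rewrite ?upd_eq ?upd_lt// => H; exists t; rewrite ?upd_eq ?upd_lt.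
  apply: (definable_ex omin (P := fun e => (a < e 1%N /\ e 1%N < b) /\ e 0%N = h (e 1%N))).
  by apply: definable_and => //; [apply: definable_and => //; [exact: lt1|exact: gt1]|exact: dh].
have hmono x y : a < x -> x < b -> a < y -> y < b -> (h x <= h y) = (x <= y).
  move=> ax xb ay yb; have [xy|yx|->] := ltgtP x y; last exact: lexx.
    by rewrite ltW// mono.
  by rewrite leNgt mono.
have [x0 x0ab [e e0 Ee]] : exists2 x0, a < x0 < b & exists2 e, 0 < e &
    forall d, 0 < d < e -> E (h x0 + d).
  apply: contrapT => noE.
  pose P (x : R) (c : rat) := h x < ratr c /\ forall t, a < t < b -> x < t -> ratr c < h t.
  apply: (@itv_uncountable R _ a b P ab) => [x xab|x y c xab yab xy [_ Hx] [Hy _]].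
    have [e e0 [He|He]] := definable_side_decided omin (h x) (or_introl erefl) dE.
      by exfalso; apply: noE; exists x => //; exists e => // d /He; rewrite mul1r.
    have [c] := @rat_in_itvoo R (h x) (h x + e) ltac:(by rewrite ltrDl).
    rewrite in_itv/= => /andP[c1 c2]; exists c; split=> // t tab xt.
    rewrite ltNge; apply/negP => tc; apply: (He (h t - h x)).
      have := mono x t; move: xab tab => /andP[-> _] /andP[_ ->] /(_ isT xt isT); lra.
    by rewrite mul1r addrCA subrr addr0; exists t; split=> //; apply/andP.
  by have := lt_trans Hy (Hx _ yab xy); rewrite ltxx.
(* All values slightly above [h x0] are attained. Hence [h] maps [[m, x1]] onto [[h m, h x1]], and
   an increasing surjection between segments is continuous. *)
have e20 : 0 < e / 2 < e by lra.
have [x1 [[ax1 x1b] hx1]] := Ee _ e20.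
have [ax0 x0b] := andP x0ab.
have x01 : x0 < x1 by rewrite ltNge -hmono// -ltNge -hx1; lra.
pose m := (x0 + x1) / 2; have mE : x0 < m < x1 by rewrite /m; lra.
have [x0m mx1] := andP mE.
exists m, x1; split=> //; first lra.
apply: segment_inc_surj_continuous => [x y|c].
  rewrite !in_itv/= => /andP[mx xx1] /andP[my yx1]; apply: hmono; lra.
rewrite /= in_itv/= => /andP[mc cx1].
have hx0m : h x0 < h m by apply: mono => //; lra.
have [|t [[at_ tb] tE]] := Ee (c - h x0); first by lra.
have ct : c = h t by rewrite -tE addrCA subrr addr0.
exists t; last by [].
have [am mb] : a < m /\ m < b by split; lra.
by rewrite in_itv/= -hmono// -ct mc /= -hmono// -ct.
Qed.

Definition tame_on (a b : R) (h : R -> R) :=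
  exists a' b', [/\ a <= a', a' < b', b' <= b, monotone_on a' b' h &
    {within `[a', b'], continuous h}].

Lemma tame_onN a b h : tame_on a b (fun t => - h t) -> tame_on a b h.
Proof.
move=> [a' [b' [aa' ab' bb' mh ch]]]; exists a', b'; split=> //.
  by case: mh => mh; [right|left] => x y x1 x2 x3; rewrite -lerN2; exact: mh.
have -> : h = (fun t => - (- h t)) by apply/funext => t; rewrite opprK.
by move=> x; apply: cvgN; exact: ch.
Qed.

Lemma const_tame_on a b c h : a < b -> (forall x, a < x < b -> h x = c) -> tame_on a b h.
Proof.
move=> ab hc; exists ((2 * a + b) / 3), ((a + 2 * b) / 3); split; try lra.
  by left => x y ? ? ?; rewrite !hc//; lra.
apply: (@subspace_eq_continuous _ _ _ (cst c)).
  by move=> x; rewrite inE/= in_itv/= => xab; rewrite /cst /from_subspace hc//; lra.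
by move=> x; exact: cvg_cst.
Qed.

Lemma definable_fun1_cst_lt h c : definable_fun1 Om h ->
  definable_in Om 1 (fun e => c < h (e 0%N)).
Proof.
move=> dh; apply: (@definable_ext _ Om 1 (fun e => exists u,
    upd e 1 u 1%N = h (upd e 1 u 0%N) /\ upd e 1 u 1%N \in `]c, +oo[)).
  move=> x; split=> [[u]|H]; last exists (h (env x 0%N)); rewrite upd_eq upd_lt// in_itv/= andbT.
    by move=> [->].
  by [].
apply: (definable_ex omin (P := fun e => e 1%N = h (e 0%N) /\ e 1%N \in `]c, +oo[)).
by apply: definable_and => //; [exact: dh|exact: definable_itv].
Qed.

(** Near [t] on the given side each strict comparison with [h t] is constantly true or constantly
    false; with both excluded, equality remains. *)
Lemma side_const h s t : (s = 1 \/ s = -1) -> definable_fun1 Om h ->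
  ~ local_above s h t -> ~ local_above s (fun u => - h u) t ->
  exists2 e, 0 < e & forall d, 0 < d < e -> h (t + s * d) = h t.
Proof.
move=> hs dh n1 n2.
have [e e0 [H|H]] := @definable_side_decided _ _ omin (fun u => h t < h u) _ t hs
    (definable_fun1_cst_lt (h t) dh).
  by exfalso; apply: n1; exists e.
have [d d0 [K|K]] := @definable_side_decided _ _ omin (fun u => - h t < - h u) _ t hs
    (definable_fun1_cst_lt (- h t) (definable_fun1N omin dh)).
  by exfalso; apply: n2; exists d.
exists (Num.min e d); first by rewrite lt_min e0.
move=> u; rewrite lt_min => /and3P[u0 ue ud]; apply/eqP; rewrite eq_le !leNgt.
apply/andP; split; apply/negP; first by apply: H; rewrite u0.
by rewrite -ltrN2; apply: K; rewrite u0.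
Qed.

Lemma const_side_tame a b t h s : (s = 1 \/ s = -1) -> definable_fun1 Om h -> a < t < b ->
  ~ local_above s h t -> ~ local_above s (fun u => - h u) t -> tame_on a b h.
Proof.
move=> hs dh /andP[at_ tb] n1 n2; have [e e0 He] := side_const hs dh n1 n2.
have widen a' b' : a <= a' -> b' <= b -> tame_on a' b' h -> tame_on a b h.
  move=> aa' bb' [c [d [? ? ? ? ?]]]; exists c, d; split=> //; lra.
case: hs He => -> He.
  pose d := Num.min e (b - t).
  have d0 : 0 < d by rewrite lt_min e0 subr_gt0.
  have de : d <= e by rewrite ge_min lexx.
  have db : d <= b - t by rewrite ge_min lexx orbT.
  apply: (@widen t (t + d)); [lra|lra|apply: (@const_tame_on _ _ (h t)); first lra].
  by move=> x xt; have := He (x - t); rewrite mul1r addrCA subrr addr0; apply; lra.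
pose d := Num.min e (t - a).
have d0 : 0 < d by rewrite lt_min e0 subr_gt0.
have de : d <= e by rewrite ge_min lexx.
have db : d <= t - a by rewrite ge_min lexx orbT.
apply: (@widen (t - d) t); [lra|lra|apply: (@const_tame_on _ _ (h t)); first lra].
by move=> x xt; have := He (t - x); rewrite mulN1r opprB addrCA subrr addr0; apply; lra.
Qed.

(** After shrinking, the comparison with values just to the left is uniform in [t]. Larger values
    would make every point a strict local minimum, smaller ones make [h] increasing, and otherwise
    [h] is constant on some interval. *)
Lemma locally_increasing_tame h a b : definable_fun1 Om h -> a < b ->
  (forall t, a < t < b -> local_above 1 h t) -> tame_on a b h.
Proof.
move=> dh ab Hr.
have [a1 [b1 [aa1 ab1 bb1 HB1]]] := definable_subitv omin ab (definable_local_above omin (-1) dh).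
have [a2 [b2 [aa2 ab2 bb2 HB2]]] :=
  definable_subitv omin ab1 (definable_local_above omin (-1) (definable_fun1N omin dh)).
have mid : a2 < (a2 + b2) / 2 < b2 by lra.
case: HB1 => HB1.
  exfalso; apply: (@strict_local_min_itv_false h a2 b2) => // t t2.
  by split; [apply: Hr|apply: HB1]; lra.
have widen a' b' : a <= a' -> b' <= b -> tame_on a' b' h -> tame_on a b h.
  move=> aa' bb' [c [d [? ? ? ? ?]]]; exists c, d; split=> //; lra.
apply: (@widen a2 b2); [lra|lra|].
case: HB2 => HB2; last first.
  apply: (@const_side_tame _ _ _ _ (-1) (or_intror erefl) dh mid); last exact: HB2.
  by apply: HB1; lra.
have inc : forall x y, a2 < x -> x < y -> y < b2 -> h x < h y.
  by apply: locally_increasing => t t2; [apply: Hr; lra|exact: HB2].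
have [a' [b' [aa' ab' bb' ch]]] := strictly_increasing_subitv_continuous dh ab2 inc.
exists a', b'; split=> //; [lra|lra|left => x y ax xy yb].
have [->|xNy] := eqVneq x y; first exact: lexx.
by apply/ltW/inc; [lra|rewrite lt_neqAle xNy|lra].
Qed.

Lemma definable_tame h a b : definable_fun1 Om h -> a < b -> tame_on a b h.
Proof.
move=> dh ab.
have [a1 [b1 [aa1 ab1 bb1 HA1]]] := definable_subitv omin ab (definable_local_above omin 1 dh).
have [a2 [b2 [aa2 ab2 bb2 HA2]]] :=
  definable_subitv omin ab1 (definable_local_above omin 1 (definable_fun1N omin dh)).
have widen a' b' : a <= a' -> b' <= b -> tame_on a' b' h -> tame_on a b h.
  move=> aa' bb' [c [d [? ? ? ? ?]]]; exists c, d; split=> //; lra.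
apply: (@widen a2 b2); [lra|lra|].
case: HA1 => HA1; first by apply: locally_increasing_tame => // t t2; apply: HA1; lra.
case: HA2 => HA2.
  by apply/tame_onN/locally_increasing_tame => //; exact: definable_fun1N.
have mid : a2 < (a2 + b2) / 2 < b2 by lra.
apply: (@const_side_tame _ _ _ _ 1 (or_introl erefl) dh mid); last exact: HA2.
by apply: HA1; lra.
Qed.

End Monotonicity.

(** * Lipschitz reparametrization of monotone curves *)

Section LipschitzReparametrization.
Context {R : realType} {n : nat}.

Lemma monotone_dist_le (h : R -> R) A B u t : monotone_on A B h ->
  A <= u -> u <= t -> t <= B ->
  `|h t - h u| <= `|h t - h A| - `|h u - h A|.
Proof.
move=> [] mh Au ut tB.
  have h1 := mh A u (lexx A) Au (le_trans ut tB); have h2 := mh u t Au ut tB.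
  by rewrite !ger0_norm ?subr_ge0//; lra.
have h1 := mh A u (lexx A) Au (le_trans ut tB); have h2 := mh u t Au ut tB.
by rewrite !ler0_norm ?subr_le0//; lra.
Qed.

(* Reparametrizing by [t + \sum_k |gam_k t - gam_k A|] makes a curve with continuous monotone
   coordinates Lipschitz. *)
Lemma monotone_curve_lipschitz (gam : R -> 'rV[R]_n) (A B : R) : A < B ->
  (forall k, monotone_on A B (fun t => gam t 0 k)) ->
  (forall k, {within `[A, B], continuous (fun t => gam t 0 k)}) ->
  exists (tau : R -> R) (L : R), [/\ tau 0 = B, tau 1 = A, forall p, A <= tau p <= B &
    forall p q, enorm (gam (tau p) - gam (tau q)) <= L * `|p - q|].
Proof.
move=> AB mh ch; pose h k t := gam t 0 k.
pose V (s : seq 'I_n) t := \sum_(k <- s) `|h k t - h k A|.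
pose sig t := t + V (enum 'I_n) t.
have cV s : {within `[A, B], continuous (V s)}.
  elim: s => [|k s IH].
    by rewrite (_ : V [::] = cst 0) => [x|]; [exact: cvg_cst|apply/funext => t; rewrite /V big_nil].
  rewrite (_ : V (k :: s) = (fun t => `|h k t - h k A| + V s t)); last first.
    by apply/funext => t; rewrite /V big_cons.
  move=> x; apply: cvgD; last exact: IH.
  by apply: cvg_norm; apply: cvgB; [exact: ch|exact: cvg_cst].
have csig : {within `[A, B], continuous sig}.
  move=> x; apply: cvgD; last exact: cV.
  by have := @continuous_subspaceT _ _ `[A, B] (@id R) (fun y => cvg_id); apply.
have V_le s u t : A <= u -> u <= t -> t <= B ->
    0 <= V s t - V s u /\ forall k, k \in s -> `|h k t - h k u| <= V s t - V s u.
  move=> Au ut tB; elim: s => [|k s [IH0 IH]].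
    by split=> [|k]; rewrite ?in_nil// /V !big_nil subrr.
  have E : V (k :: s) t - V (k :: s) u =
      (`|h k t - h k A| - `|h k u - h k A|) + (V s t - V s u).
    by rewrite /V !big_cons; ring.
  have Hk := monotone_dist_le (mh k) Au ut tB.
  have H0 := le_trans (normr_ge0 _) Hk.
  rewrite E; split=> [|j]; first by rewrite addr_ge0.
  rewrite inE => /predU1P[->|/IH Hj]; first by rewrite (le_trans Hk)// lerDl.
  by rewrite (le_trans Hj)// lerDr.
(* The summand [t] of [sig] makes it expanding, which identifies the endpoints of its inverse. *)
have sig_le u t : A <= u -> u <= t -> t <= B -> t - u <= sig t - sig u.
  by move=> Au ut tB; have [] := V_le (enum 'I_n) u t Au ut tB; rewrite /sig; lra.
have h_le u t k : A <= u -> u <= t -> t <= B -> `|h k t - h k u| <= sig t - sig u.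
  move=> Au ut tB; have [_ H] := V_le (enum 'I_n) u t Au ut tB.
  by have := H k; rewrite mem_enum => /(_ isT); rewrite /sig; lra.
have sAB : sig A <= sig B by have := sig_le A B (lexx A) (ltW AB) (lexx B); lra.
have /choice[T TP] : forall z : R, exists t, A <= t <= B /\ (sig A <= z <= sig B -> sig t = z).
  move=> z; have [zAB|] := boolP (sig A <= z <= sig B); last first.
    by exists A; split=> //; rewrite lexx ltW.
  have zI : Num.min (sig A) (sig B) <= z <= Num.max (sig A) (sig B).
    by rewrite (min_idPl sAB) (max_idPr sAB).
  have [c] := IVT (ltW AB) csig zI; rewrite in_itv/= => cAB cz; by exists c.
pose clamp (p : R) := Num.max 0 (Num.min p 1).
have clampL p q : `|clamp p - clamp q| <= `|p - q|.
  exact: le_trans (ler_dist_maxr _ _ _) (ler_dist_minl _ _ _).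
have clamp01 p : 0 <= clamp p <= 1.
  by rewrite le_max lexx/= ge_max ler01 ge_min lexx orbT.
(* The inverse of [sig] is traversed backwards, from [B] to [A]: the curve will be used with
   decreasing level. *)
pose z p := sig B - (sig B - sig A) * clamp p.
have zAB p : sig A <= z p <= sig B.
  have /andP[c0 c1] := clamp01 p; have sBA : 0 <= sig B - sig A by rewrite subr_ge0.
  by have := ler_wpM2l sBA c0; have := ler_wpM2l sBA c1; rewrite /z; lra.
have TE p : sig (T (z p)) = z p by have [_] := TP (z p); apply.
have TAB p : A <= T (z p) <= B by have [] := TP (z p).
exists (T \o z), (n%:R * (sig B - sig A)); split=> //=.
- have z0 : z 0 = sig B by rewrite /z /clamp (min_idPl ler01) maxxx mulr0 subr0.
  move: (TE 0) (TAB 0); rewrite z0 => E /andP[TA TB].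
  have := sig_le _ _ TA TB (lexx B); lra.
- have z1 : z 1 = sig A by rewrite /z /clamp minxx (max_idPr ler01); ring.
  move: (TE 1) (TAB 1); rewrite z1 => E /andP[TA TB].
  have := sig_le _ _ (lexx A) TA TB; lra.
move=> p q; rewrite -mulrA; apply: enorm_le_coord => k; rewrite !mxE.
have : `|z p - z q| <= (sig B - sig A) * `|p - q|.
  rewrite /z (_ : _ - _ = (sig B - sig A) * (clamp q - clamp p)); last by ring.
  by rewrite normrM ger0_norm ?subr_ge0// ler_wpM2l ?subr_ge0// distrC.
apply: le_trans; have /andP[pA pB] := TAB p; have /andP[qA qB] := TAB q.
have [qp|/ltW pq] := leP (T (z q)) (T (z p)).
  by have := h_le _ _ k qA qp pB; rewrite !TE => /le_trans; apply; exact: ler_norm.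
by have := h_le _ _ k pA pq qB; rewrite !TE distrC (distrC (z p)) => /le_trans; apply; exact: ler_norm.
Qed.

End LipschitzReparametrization.

(** * Noncritical levels *)

Section Sard.
Unset Implicit Arguments.
Context {R : realType} (Om : forall p : nat, set (set 'rV[R]_p)) {n : nat}.
Set Implicit Arguments.
Hypothesis omin : o_minimal_structure Om.

Definition definable_family (T : R -> set 'rV[R]_n) := forall N i o,
  (i < N)%N -> (o + n <= N)%N -> definable_in Om N (fun e => T (e i) (vec n e o)).

Definition coord_min k (T : R -> set 'rV[R]_n) t : set 'rV[R]_n :=
  [set x | T t x /\ forall y, T t y -> x 0 k <= y 0 k].

Lemma definable_coord_min k T : definable_family T -> definable_family (coord_min k T).
Proof.
move=> dT N i o iN oN; apply: definable_and => //; first exact: dT.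
apply: (@definable_ext _ Om N (fun e => forall y : 'rV[R]_n, let e' := updv e N y in
   T (e' i) (vec n e' N) -> e' (o + k)%N <= e' (N + k)%N)).
  have okN : (o + k < N)%N by rewrite (leq_trans _ oN)// ltn_add2l.
  by move=> x; split=> H y; have := H y; rewrite /= updv_lt// vec_updv updv_lt// updv_add mxE.
apply: (definable_allv omin (P := fun e' => T (e' i) (vec n e' N) -> e' (o + k)%N <= e' (N + k)%N)).
have okN : (o + k < N + n)%N by rewrite (leq_trans _ (leq_trans oN (leq_addr _ _)))// ltn_add2l.
apply: definable_imp => //; first by apply: dT => //; exact: ltn_addr.
by apply: definable_le => //; rewrite ltn_add2l.
Qed.

Lemma compact_coord_min k T t : compact (T t) -> T t !=set0 ->
  compact (coord_min k T t) /\ coord_min k T t !=set0.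
Proof.
move=> cT nT; have ck : continuous (fun x : 'rV[R]_n => x 0 k) by exact: coord_continuous.
have [x xT xmin] := EVT_min_rV nT cT (continuous_subspaceT ck).
have {}xmin y : T t y -> x 0 k <= y 0 k by move=> Ty; apply: xmin; rewrite inE.
split; last by exists x; split=> //; rewrite inE in xT.
rewrite (_ : coord_min k T t = T t `&` [set y : 'rV[R]_n | y 0 k <= x 0 k]); last first.
  apply/seteqP; split=> y [Ty yk]; split=> //; first by apply: yk; rewrite inE in xT.
  by move=> w /xmin; exact: le_trans.
apply: compact_closedI => //.
exact: (closed_comp (fun y _ => ck y) (@closed_le R (x 0 k))).
Qed.

(* Lexicographic minimization is a definable choice of a point in each compact fibre. *)
Lemma definable_selection (T : R -> set 'rV[R]_n) a : definable_family T ->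
  (forall t, a < t -> compact (T t) /\ T t !=set0) ->
  exists gam : R -> 'rV[R]_n, (forall t, a < t -> T t (gam t)) /\
    forall k, definable_fun1 Om (fun t => gam t 0 k).
Proof.
move=> dT cT.
(* Once every coordinate has been minimized, two points of a fibre have equal coordinates, so each
   fibre above [a] is a singleton. *)
have [S [dS cS ST uS]] : exists S, [/\ definable_family S,
    forall t, a < t -> compact (S t) /\ S t !=set0,
    forall t x, S t x -> T t x &
    forall t x y k, k \in enum 'I_n -> S t x -> S t y -> x 0 k <= y 0 k].
  elim: (enum 'I_n) => [|k s [S [dS cS ST uS]]]; first by exists T; split.
  exists (coord_min k S); split=> [|t /cS[c1 c2]|t x [/ST]//|t x y j].
  - exact: definable_coord_min.
  - exact: compact_coord_min.
  - by rewrite inE => /predU1P[->|js] [Sx Hx] [Sy _]; [exact: Hx|exact: uS js Sx Sy].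
(* The default 0 up to [a] makes the selection total with a definable graph. *)
have /choice[gam gamP] : forall t, exists x, (a < t -> S t x) /\ (~ a < t -> x = 0).
  move=> t; have [at_|nt] := pselect (a < t); last by exists 0.
  by have [_ [x Sx]] := cS t at_; exists x.
exists gam; split=> [t at_|k N i j iN jN]; first by apply: ST; have [+ _] := gamP t; apply.
have gamE t x : a < t -> S t x -> x = gam t.
  move=> at_ Sx; have [/(_ at_) Sg _] := gamP t; apply/rowP => l; apply/eqP.
  by rewrite eq_le !(uS t)// mem_enum.
apply: (@definable_ext _ Om N (fun e =>
  (e i \in `]a, +oo[ /\ exists x : 'rV[R]_n, let e' := updv e N x in
     S (e' i) (vec n e' N) /\ e' (N + k)%N = e' j) \/
  (~ (e i \in `]a, +oo[) /\ e j = 0))).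
  move=> x; rewrite in_itv/= andbT; split=> [[[ai [z]]|[ai ->]]|E].
  - by rewrite (updv_lt _ _ iN) (updv_lt _ _ jN) vec_updv updv_add => -[/(gamE _ _ ai)-> ->].
  - by have [_ /(_ ai)->] := gamP (env x i); rewrite mxE.
  - have [ai|ai] := pselect (a < env x i); [left|right]; split=> //.
      exists (gam (env x i)); rewrite /= (updv_lt _ _ iN) (updv_lt _ _ jN) vec_updv updv_add; split=> //.
      by have [/(_ ai)] := gamP (env x i).
    by have [_ /(_ ai) g0] := gamP (env x i); rewrite E g0 mxE.
have dI := definable_itv omin `]a, +oo[ iN.
apply: definable_or => //; apply: definable_and => //.
- apply: (definable_exv omin (P := fun e' => S (e' i) (vec n e' N) /\ e' (N + k)%N = e' j)).
  apply: definable_and => //; first by apply: dS => //; exact: ltn_addr.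
  apply: definable_eq => //; apply: polynomial_var; last exact: ltn_addr.
  by rewrite ltn_add2l.
- exact: definable_not.
- by apply: definable_eq => //; [exact: polynomial_var|exact: polynomial_cst].
Qed.

Variables (D : 'rV[R]_n -> set 'rV[R]_n) (f : 'rV[R]_n -> R).

(* For compact [D x] this means that [0] is in the convex hull of [D x]. *)
Definition critical (x : 'rV[R]_n) := forall v, exists l, D x l /\ dot v l <= 0.

Lemma definable_critical N o : definable_map Om D -> (o + n <= N)%N ->
  definable_in Om N (fun e => critical (vec n e o)).
Proof.
move=> dD oN.
apply: (@definable_ext _ Om N (fun e => forall v : 'rV[R]_n, let e' := updv e N v in
   exists l : 'rV[R]_n, let e'' := updv e' (N + n) l in
   D (vec n e'' o) (vec n e'' (N + n)) /\ dot (vec n e'' N) (vec n e'' (N + n)) <= 0)).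
  have E (x : 'rV[R]_N) (v l : 'rV[R]_n) : [/\
      vec n (updv (updv (env x) N v) (N + n) l) o = vec n (env x) o,
      vec n (updv (updv (env x) N v) (N + n) l) N = v &
      vec n (updv (updv (env x) N v) (N + n) l) (N + n) = l].
    rewrite vec_updv_lt ?(leq_trans oN) ?leq_addr// vec_updv_lt//.
    by rewrite vec_updv_lt ?vec_updv.
  move=> x; split=> H v; have [l Hl] := H v; exists l;
    by have [E1 E2 E3] := E x v l; move: Hl; rewrite /= E1 E2 E3.
apply: (definable_allv omin (P := fun e' => exists l : 'rV[R]_n, let e'' := updv e' (N + n) l in
   D (vec n e'' o) (vec n e'' (N + n)) /\ dot (vec n e'' N) (vec n e'' (N + n)) <= 0)).
apply: (definable_exv omin (P := fun e'' => D (vec n e'' o) (vec n e'' (N + n)) /\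
   dot (vec n e'' N) (vec n e'' (N + n)) <= 0)).
have oN' : (o + n <= N + n + n)%N by rewrite -addnA (leq_trans oN)// leq_addr.
apply: definable_and => //; first exact: definable_rel.
by apply: definable_dot_le0 => //; exact: leq_addr.
Qed.

(** A direction having positive product with all of [D x] keeps this property near [x], so
    noncriticality is open. *)
Lemma closed_critical : graph_closed D -> locally_bounded D -> closed critical.
Proof.
move=> Dc Db x clx v; apply: contrapT => nl.
have [l Dl|c [r [c0 r0 H]]] := graph_closed_usc Dc Db (x := x) (u := v) (c := 0).
  by rewrite ltNge; apply/negP => lv; apply: nl; exists l; rewrite dotC.
have [|y [ycrit yx]] := clx [set y | enorm (y - x) <= r].
  by apply/nbhs_enormP; exists r.
have [l [Dl lv]] := ycrit v.
by have := H y l yx Dl; rewrite dotC leNgt (le_lt_trans lv).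
Qed.

Lemma regular_level a : conservative_field D f -> continuous f ->
  definable_fun Om f -> definable_map Om D ->
  (forall r, exists B, forall x, f x <= r -> enorm x <= B) ->
  exists2 r, a < r & forall x, f x = r -> exists v, forall l, D x l -> 0 < dot l v.
Proof.
move=> Df fc df dD fB; apply: contrapT => noreg.
pose T t : set 'rV[R]_n := [set x | f x = t /\ critical x].
have dT : definable_family T.
  move=> N i o iN oN; apply: definable_and => //; last exact: definable_critical.
  have dS : definable_map Om (fun x : 'rV[R]_n => [set d : 'rV[R]_1 | d = const_mx (f x)]).
    rewrite /definable_map (_ : [set z | _] = [set z | exists x, z = row_mx x (const_mx (f x))])//.
    apply/seteqP; split=> z /= [x]; first by move=> [d [-> ->]]; exists x.
    by move=> ->; exists x, (const_mx (f x)).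
  have iN1 : (i + 1 <= N)%N by rewrite addn1.
  apply: definable_ext (definable_rel omin dS oN iN1) => x /=; split=> [/rowP/(_ 0)|E].
    by rewrite !mxE addn0.
  by apply/rowP => j; rewrite !mxE ord1 addn0 E.
have cT t : a < t -> compact (T t) /\ T t !=set0.
  move=> at_; split.
    have [B HB] := fB t; apply: (@compact_enorm_le _ _ _ B) => [|x [xt _]]; last first.
      by apply: HB; rewrite xt.
    rewrite (_ : T t = f @^-1` [set t] `&` critical)//.
    apply: closedI; last first.
      exact: closed_critical (conservative_graph_closed Df) (conservative_locally_bounded Df).
    exact: (closed_comp (fun y _ => fc y) (@closed_eq R t)).
  apply: contrapT => /set0P/negP/negPn/eqP T0; apply: noreg; exists t => // x xt.
  apply: contrapT => nov.
  suff : T t x by rewrite T0.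
  split=> // v; apply: contrapT => nol; apply: nov; exists v => l Dl.
  by rewrite ltNge; apply/negP => lv; apply: nol; exists l; rewrite dotC.
have [gam [gamT dgam]] := definable_selection dT cT.
have [A [B [aA AB mon con]]] : exists A B, [/\ a < A, A < B,
    forall k, monotone_on A B (fun t => gam t 0 k) &
    forall k, {within `[A, B], continuous (fun t => gam t 0 k)}].
  have [A [B [aA AB H]]] : exists A B, [/\ a < A, A < B &
      forall k, k \in enum 'I_n -> monotone_on A B (fun t => gam t 0 k) /\
        {within `[A, B], continuous (fun t => gam t 0 k)}].
    elim: (enum 'I_n) => [|k s [A [B [aA AB H]]]].
      by exists (a + 1), (a + 2); split=> //; lra.
    have [A' [B' [AA' AB' BB' mk ck]]] := definable_tame omin (dgam k) AB.
    exists A', B'; split=> //; first exact: lt_le_trans AA'.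
    move=> j; rewrite inE => /predU1P[->//|/H[mj cj]]; split.
      case: mj => mj; [left|right] => x y x1 x2 x3; apply: mj => //; lra.
    apply: continuous_subspaceW cj => x /=; rewrite !in_itv/=; lra.
  by exists A, B; split=> // k; have [] := H k; rewrite ?mem_enum.
have [tau [L [t0 t1 tAB tL]]] := monotone_curve_lipschitz AB mon con.
have tT p : T (tau p) (gam (tau p)).
  by apply: gamT; have /andP[+ _] := tAB p; exact: lt_le_trans.
(* Criticality tested on [- l] gives an element of [D] with nonnegative product with the velocity
   [l], so [f] does not decrease from [gam B] to [gam A], although its values there are [B] and
   [A]. *)
have := conservative_curve_increase Df (lexx 0) tL.
rewrite /= t0 t1 addr0 => H; have : f (gam B) <= f (gam A).
  apply: H => s l _ _; have [_ /(_ (- l))[d [Dd]]] := tT s.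
  by rewrite dotNl oppr_le0 dotC; exists d.
have [-> _] := gamT A aA; have [-> _] := gamT B (lt_trans aA AB).
by rewrite leNgt AB.
Qed.

End Sard.

(** * Momentum and the main estimate *)

Section Coercive.
Context {R : realType} {n : nat}.
Variable f : 'rV[R]_n -> R.

Lemma locally_lipschitz_continuous : locally_lipschitz f -> continuous f.
Proof.
move=> fL x; have [L [U xU UL]] := fL x.
have Ux : U x by exact: nbhs_singleton.
apply/(@cvgrPdist_le _ _ _ (nbhs x) (nbhs_filter x)) => e e0.
have L0 : 0 < `|L| + 1 by rewrite ltr_wpDl.
have nx : nbhs x [set y | enorm (y - x) <= e / (`|L| + 1)].
  by apply/nbhs_enormP; exists (e / (`|L| + 1)) => //; rewrite divr_gt0.
apply: (@filterS _ (nbhs x) _ (U `&` [set y | enorm (y - x) <= e / (`|L| + 1)])).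
  2: exact: filterI.
move=> y [Uy /= yx].
rewrite distrC; apply: (le_trans (UL _ _ Uy Ux)).
move: yx; rewrite ler_pdivlMr// => /(le_trans _); apply.
rewrite mulrC ler_wpM2l ?enorm_ge0//.
by have := ler_norm L; lra.
Qed.

Lemma coercive_sublevel_bounded : coercive f -> forall r,
  exists B, forall x, f x <= r -> enorm x <= B.
Proof.
move=> fc r; apply: contrapT => noB.
have /choice[y yP] : forall k : nat, exists x, f x <= r /\ k%:R <= enorm x.
  move=> k; apply: contrapT => nox; apply: noB; exists k%:R => x fx.
  by rewrite leNgt; apply/negP => kx; apply: nox; exists x; split=> //; exact: ltW.
have : f (y k) @[k --> \oo] --> +oo.
  apply: fc; apply/cvgryPge => A; have := nbhs_infty_ger A.
  by apply: filterS => k /= Ak; have [_] := yP k; exact: le_trans.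
move=> /cvgryPgt/(_ r)/filter_ex[k /=]; have [+ _] := yP k.
by move=> /le_lt_trans/[apply]; rewrite ltxx.
Qed.

(** Uniform continuity on a ball; the 1 is the gap between the levels [r] and [r + 1]. *)
Lemma continuous_unif_bounded B : continuous f ->
  exists2 rho, 0 < rho & forall y z, enorm y <= B -> enorm (z - y) <= rho -> f z < f y + 1.
Proof.
move=> fc; apply: contrapT => norho.
have /choice[p pP] : forall k : nat, exists p : 'rV[R]_n * 'rV[R]_n,
    [/\ enorm p.1 <= B, enorm (p.2 - p.1) <= k.+1%:R^-1 & f p.1 + 1 <= f p.2].
  move=> k; apply: contrapT => nop; apply: norho; exists k.+1%:R^-1 => // y z yB zy.
  by rewrite ltNge; apply/negP => fzy; apply: nop; exists (y, z).
have [U [UU oU]] := ultraFilterLemma eventually_filter.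
have [y yU] : exists y : 'rV[R]_n, (fun k => (p k).1) @ U --> y.
  by apply: (@ultra_bounded_cvg _ _ U UU (fun k => (p k).1) B) => k; have [] := pP k.
have zU : (fun k => (p k).2) @ U --> y.
  apply/cvg_enormP => e e0; have e20 : 0 < e / 2 by rewrite divr_gt0.
  apply: filterS2 (ultra_natSinv_le oU e20) (proj1 (cvg_enormP _ _) yU _ e20) => k k1 k2.
  have [_ h _] := pP k; have := ler_enorm_distD (p k).1 (p k).2 y.
  by have := le_trans h k1; lra.
have fyU : f (p k).1 @[k --> U] --> f y by apply: continuous_cvg => //; exact: fc.
have fzU : f (p k).2 @[k --> U] --> f y by apply: continuous_cvg => //; exact: fc.
have e4 : 0 < 4^-1 :> R by rewrite invr_gt0.
have [k [/= _ h1 h2]] := ultra_ex3 (UU := UU) (@filterT _ U _)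
  (proj1 (cvgrPdist_le _ _) fyU _ e4) (proj1 (cvgrPdist_le _ _) fzU _ e4).
have [_ _ h3] := pP k.
move: h1 h2; rewrite !ler_norml => /andP[? ?] /andP[? ?]; lra.
Qed.

End Coercive.

(** With [h = eta_k] and [V = W_(k+1)] this dictates the weights: [W_k = beta * (h + V)] makes the
    shifted iterate take a pure gradient step, of size [w_k = (1 - beta) * (h + V)]. *)
Lemma momentum_step (R : realType) (n : nat) (beta h V : R) (x m g : 'rV[R]_n) :
  x - h *: (beta *: m + (1 - beta) *: g) - V *: (beta *: m + (1 - beta) *: g) =
  x - (beta * (h + V)) *: m - ((1 - beta) * (h + V)) *: g.
Proof.
rewrite -addrA -opprD -scalerDl scalerDr !scalerA opprD addrA.
by rewrite (mulrC _ beta) (mulrC _ (1 - beta)).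
Qed.

Section MomentumTail.
Context {R : realType}.
Variables (beta s : R) (eta : nat -> R) (M : nat).
Hypothesis beta01 : 0 <= beta < 1.
Hypothesis eta_bnd : forall k, 0 <= eta k <= s.

(* [tail k = \sum_(k <= j < M) beta ^+ (j - k).+1 * eta j], the total weight with which the
   current momentum enters the remaining steps. *)
Fixpoint rev_tail j : R :=
  if j is j'.+1 then beta * (eta (M - j'.+1)%N + rev_tail j') else 0.

Definition tail k := rev_tail (M - k).

Lemma tail_last : tail M = 0.
Proof. by rewrite /tail subnn. Qed.

Lemma tailE k : (k < M)%N -> tail k = beta * (eta k + tail k.+1).
Proof.
move=> kM; rewrite /tail -(subnSK kM) /= subnSK// subKn//; exact: ltnW.
Qed.

(** The bound is the fixed point of [W |-> beta * (s + W)], the sum of a geometric series. *)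
Lemma tail_bnd k : 0 <= tail k <= s * beta / (1 - beta).
Proof.
have /andP[b0 b1] := beta01; have b1' : 0 < 1 - beta by rewrite subr_gt0.
rewrite /tail; elim: (M - k)%N => [|j /andP[h0 h1]] /=.
  have s0 : 0 <= s by have /andP[] := eta_bnd 0%N; exact: le_trans.
  by rewrite lexx/=; apply: divr_ge0; [exact: mulr_ge0|exact: ltW].
have /andP[e0 e1] := eta_bnd (M - j.+1)%N.
rewrite mulr_ge0 ?addr_ge0//=.
have -> : s * beta / (1 - beta) = beta * (s + s * beta / (1 - beta)).
  by field; rewrite gt_eqF.
by rewrite ler_wpM2l// lerD.
Qed.

End MomentumTail.

Unset Implicit Arguments.
Set Strict Implicit.

Theorem theorem3p18 (R : realType) (Om : forall p : nat, set (set 'rV[R]_p))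
    (n : nat) (f : 'rV[R]_n -> R) (D : 'rV[R]_n -> set 'rV[R]_n)
    (beta eps0 : R) (m0 : 'rV[R]_n) (X0 : set 'rV[R]_n) :
  o_minimal_structure Om ->
  locally_lipschitz f -> definable_fun Om f ->
  conservative_field D f -> definable_map Om D ->
  coercive f ->
  0 <= beta < 1 -> 0 < eps0 -> compact X0 ->
  exists alpha r : R, [/\ 0 < alpha, 0 < r &
    forall (x m g : nat -> 'rV[R]_n) (eta mu tau : nat -> R),
      m 0%N = m0 ->
      (forall k : nat,
        [/\ conv_hull (D (x k)) (g k),
            eta k = mu k / Num.sqrt
              (eps0 + \sum_(1 <= i < k.+1) tau i * enorm (m i) ^+ 2),
            m k.+1 = beta *: m k + (1 - beta) *: g k &
            x k.+1 = x k - eta k *: m k.+1]) ->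
      (forall k : nat, 0 < tau k /\ 0 < mu k) ->
      nondecreasing_seq tau -> nondecreasing_seq mu ->
      (exists psi : 'rV[R]_n -> R,
        [/\ forall y, 0 <= psi y,
            locally_bounded_fun psi &
            forall k : nat, Num.max (tau k) (mu k) <=
              sup [set psi (x i) | i in [set i : nat | (i <= k)%N]]]) ->
      X0 (x 0%N) ->
      (ereal_sup [set (mu k)%:E | k in [set: nat]] <= alpha%:E)%E ->
      forall k : nat, f (x k) <= r].
Proof.
move=> omin flip df Df dD fcoer /andP[b0 b1] eps_gt0 cX0.
have fc := locally_lipschitz_continuous flip.
have fB := coercive_sublevel_bounded fcoer.
have beta01 : 0 <= beta < 1 by rewrite b0.
have b1' : 0 < 1 - beta by rewrite subr_gt0.
have [a aX0] : exists a, forall y, X0 y -> f y <= a.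
  have := compact_bounded (continuous_compact (continuous_subspaceT fc) cX0).
  move=> [b [_ Hb]]; exists (b + 1) => y Xy.
  by apply: (le_trans (ler_norm _)); apply: (Hb (b + 1)); [rewrite ltrDl|exists y].
(* The margin 1 above [a] lets the shifted start [y 0] remain below [r]; the 0 makes the final level
   positive. *)
have [r ar freg] := regular_level omin (Num.max (a + 1) 0) Df fc df dD fB.
have [{}ar r0] : a + 1 < r /\ 0 < r by move: ar; rewrite gt_max => /andP.
have [B1 HB1] := fB r; have [B HB] := fB (r + 1).
have [M0 HM0] : exists G, forall y l, enorm y <= B -> D y l -> enorm l <= G.
  have cB : compact [set y : 'rV[R]_n | enorm (y - 0) <= B].
    apply: (@compact_enorm_le _ _ _ B); first exact: closed_enorm_le.
    by move=> y /=; rewrite subr0.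
  have [G HG] := conservative_locally_bounded Df cB.
  by exists G => y l yB; apply: HG; rewrite /= subr0.
(* Momenta are convex combinations of [m0] and earlier gradients, so [G] bounds them too. *)
pose G := Num.max (enorm m0) M0.
have G0 : 0 <= G by rewrite le_max enorm_ge0.
have [rho rho0 unif] := continuous_unif_bounded B fc.
have G1 : 0 < 1 + G by rewrite ltr_wpDr.
(* At speed at most [G], a move lasting at most [T] has length at most [rho] and raises [f] by less
   than 1. *)
pose T := rho / (1 + G).
have T0 : 0 < T by rewrite divr_gt0.
have GT : G * T <= rho.
  by rewrite /T mulrCA (ler_piMr (ltW rho0))// ler_pdivrMr// mul1r; lra.
have [d d0 noesc] := no_escape Df fc HB1 freg T0 G0.
(* [c] is the allowed distance from [x k] to [y k]. The factor [(1 - beta) / (1 + G)] in the step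
   bound [s] brings the geometric weight times the momentum bound below [c]. *)
pose c := Num.min d rho; have c0 : 0 < c by rewrite lt_min d0.
pose s := c * (1 - beta) / (1 + G).
have s0 : 0 < s by rewrite divr_gt0// mulr_gt0.
have sc : s <= c.
  by rewrite /s ler_pdivrMr// (ler_wpM2l (ltW c0))//; lra.
have tailc : s * beta / (1 - beta) * G <= c.
  have -> : s * beta / (1 - beta) = c * (beta / (1 + G)).
    by rewrite /s; field; rewrite !gt_eqF.
  rewrite -mulrA (ler_piMr (ltW c0))// mulrAC ler_pdivrMr// mul1r.
  by have := ler_wpM2r G0 (ltW b1); lra.
exists (s * Num.sqrt eps0), (r + 1); split; first by rewrite mulr_gt0// sqrtr_gt0.
  by rewrite ltr_wpDr.
move=> x m g eta mu tau m00 rec pos _ _ _ x0X mu_le.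
have eta_bnd k : 0 <= eta k <= s.
  have [_ -> _ _] := rec k; have [_ mu0] := pos k.
  have sq0 : 0 < Num.sqrt eps0 by rewrite sqrtr_gt0.
  have sqk : Num.sqrt eps0 <= Num.sqrt
      (eps0 + \sum_(1 <= i < k.+1) tau i * enorm (m i) ^+ 2).
    rewrite ler_wsqrtr// lerDl; apply: sumr_ge0 => i _.
    by rewrite mulr_ge0 ?sqr_ge0//; have [/ltW] := pos i.
  have sqk0 := lt_le_trans sq0 sqk.
  rewrite (divr_ge0 (ltW mu0) (ltW sqk0))/= ler_pdivrMr//.
  apply: (@le_trans _ _ (s * Num.sqrt eps0)); last exact: ler_wpM2l (ltW s0) _ _ sqk.
  by rewrite -lee_fin; apply: le_trans mu_le; apply: ereal_sup_ubound; exists k.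
move=> K; rewrite leNgt; apply/negP => Kr.
have exP : exists k, r + 1 < f (x k) by exists K.
case: (ex_minnP exP) => M Mr Mmin {K Kr exP}.
have xr k : (k < M)%N -> f (x k) <= r + 1.
  by move=> kM; rewrite leNgt; apply/negP => /Mmin; rewrite leqNgt kM.
have M0' : (0 < M)%N.
  rewrite lt0n; apply/negP => /eqP M00; move: Mr; rewrite M00.
  by have := aX0 _ x0X; lra.
have gG k : (k < M)%N -> enorm (g k) <= G.
  move=> kM; have [gk _ _ _] := rec k; apply: conv_hull_enorm_le gk => l Dl.
  by rewrite le_max (HM0 (x k) l)// ?orbT// HB// xr.
have mG k : (k <= M)%N -> enorm (m k) <= G.
  elim: k => [_|k IH kM]; first by rewrite m00 le_max lexx.
  have [_ _ -> _] := rec k; apply: (le_trans (ler_enormD _ _)).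
  rewrite !enormZ (ger0_norm b0) (ger0_norm (ltW b1')).
  have := ler_wpM2l b0 (IH (ltnW kM)); have := ler_wpM2l (ltW b1') (gG k kM); lra.
(* The weights stop at the exit index [M]: there [W M = 0], so [y M = x M] has itself passed the
   level [r + 1]. *)
pose W := tail beta eta M.
have W_bnd k : 0 <= W k <= s * beta / (1 - beta) by exact: tail_bnd.
pose y k := x k - W k *: m k.
pose w k := (1 - beta) * (eta k + W k.+1).
have yS k : (k < M)%N -> y k.+1 = y k - w k *: g k.
  move=> kM; have [_ _ mk xk] := rec k.
  by rewrite /y /w {2}/W tailE// -/W xk mk momentum_step.
have w_bnd k : 0 <= w k <= s.
  have /andP[e0 e1] := eta_bnd k; have /andP[W0 W1] := W_bnd k.+1.
  rewrite (mulr_ge0 (ltW b1') (addr_ge0 e0 W0))/=.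
  have -> : s = (1 - beta) * (s + s * beta / (1 - beta)) by field; rewrite gt_eqF.
  by rewrite (ler_wpM2l (ltW b1'))// lerD.
have xy k : (k <= M)%N -> enorm (x k - y k) <= c.
  move=> kM; rewrite /y opprB addrCA subrr addr0 enormZ.
  have /andP[W0 W1] := W_bnd k; rewrite ger0_norm//.
  by apply: le_trans tailc; apply: ler_pM => //; [exact: enorm_ge0|exact: mG].
have yM : y M = x M by rewrite /y /W tail_last scale0r subr0.
have cd : c <= d by rewrite ge_min lexx.
have crho : c <= rho by rewrite ge_min lexx orbT.
have y0r : f (y 0%N) <= r.
  have fx0 := aX0 _ x0X.
  have : f (y 0%N) < f (x 0%N) + 1.
    apply: unif; first by apply: HB; lra.
    by rewrite enormBC (le_trans (xy 0%N (leq0n _))).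
  lra.
pose P k := (k <= M)%N && (f (y k) <= r).
have P0 : exists k, P k by exists 0%N; rewrite /P.
have PM k : P k -> (k <= M)%N by case/andP.
case: (ex_maxnP P0 PM) => i /andP[iM yir] imax.
have shift k : (k < M - i)%N -> (i + k < M)%N by rewrite ltn_subRL.
apply: (noesc (Run (fun k => y (i + k)%N) (fun k => x (i + k)%N) (fun k => g (i + k)%N)
  (fun k => w (i + k)%N) (M - i))).
split=> /=.
- by rewrite addn0.
- move=> k /andP[k0 kM]; rewrite leNgt; apply/negP => yk.
  have /imax : P (i + k)%N by rewrite /P ltW// andbT -leq_subRL.
  by rewrite -{2}(addn0 i) leq_add2l leqNgt k0.
(* A run shorter than [T] could not lift [f] from at most [r] at [y i] to more than [r + 1] at
   [y M]. *)
- rewrite leNgt; apply/negP => elT.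
  have : f (y M) < f (y i) + 1.
    apply: unif; first by apply: HB; lra.
    have H := @elapsed_dist R n (fun k => y (i + k)%N) (fun k => g (i + k)%N)
      (fun k => w (i + k)%N) (M - i) s G _ _ _ 0%N (M - i)%N.
    apply: (@le_trans _ _ (G * T)) => //.
    apply: (@le_trans _ _ (G * (elapsed (fun k => w (i + k)%N) (M - i) -
       elapsed (fun k => w (i + k)%N) 0))).
      move: H; rewrite addn0 subnKC//; apply => // [k /shift/gG//|k /shift kM|].
        by rewrite addnS yS.
      by rewrite leqnn.
    by rewrite elapsed0 subr0 (ler_wpM2l G0)// ltW.
  rewrite yM; lra.
- move=> k /shift kM; have [gk _ _ _] := rec (i + k)%N; split=> //.
  + by have /andP[-> /le_trans->//] := w_bnd (i + k)%N; exact: le_trans cd.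
  + exact: gG.
  + by rewrite (le_trans (xy _ (ltnW kM))).
  + by rewrite addnS yS.
Qed.
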